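(* Let $K$ be any infinite field. For every $n\in\mathbb{N}$, the generic subrank $Q(n)=Q(n,n,n)$ of tensors in $K^n\otimes K^n\otimes K^n$ equals $\lfloor\sqrt{3n-2}\rfloor$.
   Context: $\mathbb{N}$ denotes the positive integers. Write $K^{n_1,\dots,n_k}:=K^{n_1}\otimes\cdots\otimes K^{n_k}$. For tensors $S\in K^{m_1,\dots,m_k}$ and $T\in K^{n_1,\dots,n_k}$ write $S\le T$ if there are linear maps $A_i:K^{n_i}\to K^{m_i}$ with $(A_1\otimes\cdots\otimes A_k)T=S$. For $s\ge 0$ let $I_s=\sum_{j=1}^s e_j\otimes\cdots\otimes e_j$ ($k$ factors, $e_1,\dots,e_s$ the standard basis of $K^s$) be the unit tensor of size $s$. The subrank $Q(T)$ of $T\in K^{n_1,\dots,n_k}$ is the largest integer $s\ge 0$ with $I_s\le T$. Let $\mathcal{C}_r^{(n_1,\dots,n_k)}=\{T\in K^{n_1,\dots,n_k} : Q(T)\ge r\}$. The generic subrank $Q(n_1,\dots,n_k)$ is the largest $r$ such that $\mathcal{C}_r^{(n_1,\dots,n_k)}$ is Zariski-dense in $K^{n_1,\dots,n_k}$; $Q(n)$ is shorthand for $Q(n,n,n)$. *)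

(* Defs.v *)
From HB Require Import structures.
From mathcomp Require Import all_boot all_order all_algebra.
From mathcomp Require Import mpoly.

Set Implicit Arguments.
Unset Strict Implicit.
Unset Printing Implicit Defensive.

Import GRing.Theory.
Local Open Scope ring_scope.

Definition infinite_type (T : eqType) : Prop :=
  ~ (exists s : seq T, forall x : T, x \in s).

(* K^a (x) K^b (x) K^c, in coordinates with respect to the basis
   e_i (x) e_j (x) e_k. *)
Notation tensor K a b c := {ffun 'I_a * 'I_b * 'I_c -> K}.

Definition pure_tensor (K : fieldType) (a b c : nat)
    (u : 'cV[K]_a) (v : 'cV[K]_b) (w : 'cV[K]_c) : tensor K a b c :=
  [ffun x => u x.1.1 0 * v x.1.2 0 * w x.2 0].

(* (A (x) B (x) C) T, a linear map K^n -> K^m being given by its m x n matrix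
   acting on column vectors. *)
Definition tensor_map (K : fieldType) (m1 m2 m3 n1 n2 n3 : nat)
    (A : 'M[K]_(m1, n1)) (B : 'M[K]_(m2, n2)) (C : 'M[K]_(m3, n3))
    (T : tensor K n1 n2 n3) : tensor K m1 m2 m3 :=
  [ffun x => \sum_(y : 'I_n1 * 'I_n2 * 'I_n3)
     A x.1.1 y.1.1 * B x.1.2 y.1.2 * C x.2 y.2 * T y].

Definition restricts (K : fieldType) (m1 m2 m3 n1 n2 n3 : nat)
    (S : tensor K m1 m2 m3) (T : tensor K n1 n2 n3) : Prop :=
  exists (A : 'M[K]_(m1, n1)) (B : 'M[K]_(m2, n2)) (C : 'M[K]_(m3, n3)),
    tensor_map A B C T = S.

Definition unit_tensor (K : fieldType) (s : nat) : tensor K s s s :=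
  \sum_(j < s) pure_tensor (delta_mx j 0) (delta_mx j 0) (delta_mx j 0).

Definition is_largest (P : nat -> Prop) (m : nat) : Prop :=
  P m /\ (forall s : nat, P s -> (s <= m)%N).

(* Q(T) = s, as a relation: over an arbitrary field, the maximum is not
   computable. *)
Definition is_subrank (K : fieldType) (n1 n2 n3 : nat)
    (T : tensor K n1 n2 n3) (s : nat) : Prop :=
  is_largest (fun s' => restricts (unit_tensor K s') T) s.

Definition subrank_ge (K : fieldType) (n1 n2 n3 : nat) (r : nat)
    (T : tensor K n1 n2 n3) : Prop :=
  exists2 s : nat, is_subrank T s & (r <= s)%N.

(* The tensor entries serve as the variables, numbered by the enumeration of
   the index type. *)
Definition tensor_eval (K : fieldType) (n1 n2 n3 : nat)
    (p : {mpoly K[#|{: 'I_n1 * 'I_n2 * 'I_n3}|]})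
    (T : tensor K n1 n2 n3) : K :=
  p.@[fun i => T (enum_val i)].

Definition zariski_closed (K : fieldType) (n1 n2 n3 : nat)
    (Z : tensor K n1 n2 n3 -> Prop) : Prop :=
  exists F : {mpoly K[#|{: 'I_n1 * 'I_n2 * 'I_n3}|]} -> Prop,
    forall T : tensor K n1 n2 n3,
      Z T <-> (forall p, F p -> tensor_eval p T = 0).

(* The only Zariski-closed set containing C is the whole space. *)
Definition zariski_dense (K : fieldType) (n1 n2 n3 : nat)
    (C : tensor K n1 n2 n3 -> Prop) : Prop :=
  forall Z : tensor K n1 n2 n3 -> Prop,
    zariski_closed Z -> (forall T, C T -> Z T) -> forall T, Z T.

Definition is_generic_subrank (K : fieldType) (n1 n2 n3 : nat) (q : nat) : Prop :=
  is_largest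
    (fun r => zariski_dense (fun T : tensor K n1 n2 n3 => subrank_ge r T)) q.

(* Main.v *)
Require Import Defs.
From Stdlib Require Import Classical.
From mathcomp Require Import all_boot all_order all_algebra.
From mathcomp Require Import mpoly zify ring.

Set Implicit Arguments.
Unset Strict Implicit.
Unset Printing Implicit Defensive.

Import GRing.Theory.
Local Open Scope ring_scope.

(** The tensors of subrank at least [r] are those that restrict to the unit tensor
    of size [r]. Both bounds come from one polynomial parametrization of this set
    ([assemble], [restricts_unit_assemble]). If matrices [A1], [A2],
    [A3] with an identity minor send [T] to a sum of [r] rank one tensors, then the
    entries of [T] on the block of the chosen minors are polynomials in the other
    entries of [T], in the remaining entries of the [A_t], and in the vectors of
    the rank one tensors, two of which are normalized in each summand.

    Upper bound. The parameters are [n^3 - r^3 + 3 r (n - r) + r (3 r - 2)] in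
    number, which is less than [n^3] when [r^2 > 3 n - 2]. A polynomial map from
    a space of smaller dimension has its image in a hypersurface
    ([polynomial_map_not_dominant]), so [subrank_ge_not_dense].

    Lower bound. If the differential of the parametrization is onto at one point,
    no nonzero polynomial vanishes on its image ([nonvanishing_along_jets]). At the
    base point chosen here, where the matrices are [[1 | 0]], the rank one tensors
    form the unit tensor and the slices of [T] next to the block are arbitrary
    matrices, this becomes a statement about three families of [d = n - r]
    matrices of size [r]: the only tensor with zero entries wherever two indices
    coincide, all of whose slices in the mode [t] are orthogonal to the family [t]
    for [t = 1, 2, 3], is [0] ([separating], [separable_dense]). There are
    [r (r - 1) (r - 2)] unknowns and [3 d r] equations, and [r^2 <= 3 n - 2] means
    [(r - 1) (r - 2) <= 3 d]: the system is at best square.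

    Such families are built by adding one index at a time ([separating_extend]).
    The old tensor is forced to vanish by the old equations; what remains are
    three slices through the new index, and the matrices can be specialized so
    that each equation either kills one cell or identifies two cells of different
    slices. The slices vanish if the graph of identified cells is a forest all of
    whose trees contain a diagonal or a killed cell. In the main step the trees are
    stars with centres in one slice ([star_slices_determined]); it enlarges two of
    the families. Alternating the modes of the centres keeps the three families of
    equal size up to rounding ([separable_six_steps]), with two small sizes
    reached by a variant of the step. *)

(** * Polynomials over an infinite field *)

Lemma infinite_uniq_seq (T : eqType) : infinite_type T ->
  forall k, exists2 s : seq T, uniq s & size s = k.
Proof.
move=> hT; elim=> [|k [s us <-]]; first by exists [::].
have [x xs] : exists x : T, x \notin s.
  apply: NNPP => nex; apply: hT; exists s => x.
  by case: (boolP (x \in s)) => // xs; case: nex; exists x.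
by exists (x :: s); rewrite //= xs us.
Qed.

Lemma poly_nonroot (K : fieldType) (f : {poly K}) :
  infinite_type K -> f != 0 -> exists x, f.[x] != 0.
Proof.
move=> hK f0; have [s us ss] := infinite_uniq_seq hK (size f).
have /allPn [x _ fx] : ~~ all (root f) s.
  by apply/negP => /(max_poly_roots f0) /(_ us); rewrite ss ltnn.
by exists x.
Qed.

Lemma base_digits_inj (B n : nat) (f g : nat -> nat) :
    (forall i, (f i < B)%N) -> (forall i, (g i < B)%N) ->
    (\sum_(i < n) f i * B ^ i = \sum_(i < n) g i * B ^ i)%N ->
  forall i, (i < n)%N -> f i = g i.
Proof.
elim: n f g => [|n IHn] f g fB gB //.
have shift (h : nat -> nat) :
    (\sum_(i < n.+1) h i * B ^ i = (\sum_(i < n) h i.+1 * B ^ i) * B + h 0)%N.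
  rewrite big_ord_recl /= expn0 muln1 addnC big_distrl /=; congr (_ + _)%N.
  by apply: eq_bigr => i _; rewrite expnSr mulnA.
have B0 : (0 < B)%N by apply: leq_ltn_trans (fB 0).
rewrite !shift => E.
have E0 : f 0 = g 0.
  by move: (congr1 (modn^~ B) E); rewrite !modnMDl !modn_small.
have E1 : (\sum_(i < n) f i.+1 * B ^ i = \sum_(i < n) g i.+1 * B ^ i)%N.
  by move: (congr1 (divn^~ B) E); rewrite !divnMDl // !divn_small // !addn0.
case=> [//|i]; rewrite ltnS => lt_i.
by apply: (IHn (fun j => f j.+1) (fun j => g j.+1)) => // j.
Qed.

(** Kronecker substitution: for [B] beyond all exponents, replacing the
    [i]-th variable by ['X^(B ^ i)] sends distinct monomials to distinct powers
    of ['X], so a nonzero polynomial stays nonzero. *)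
Lemma mpoly_nonroot (K : fieldType) (n : nat) (p : {mpoly K[n]}) :
  infinite_type K -> p != 0 -> exists v : 'I_n -> K, p.@[v] != 0.
Proof.
move=> hK p0; pose B := msize p.
pose code (m : 'X_{1..n}) := (\sum_(i < n) m i * B ^ i)%N.
pose f : {poly K} := \sum_(m <- msupp p) p@_m *: 'X^(code m).
have lt_B m (i : 'I_n) : m \in msupp p -> (m i < B)%N.
  move=> /msize_mdeg_lt; apply: leq_ltn_trans.
  by rewrite mdegE (bigD1 i) //= leq_addr.
have code_inj m1 m2 : m1 \in msupp p -> m2 \in msupp p ->
    code m1 = code m2 -> m1 = m2.
  move=> s1 s2 E; apply/mnmP => i.
  pose d (m : 'X_{1..n}) j := if insub j is Some k then m k else 0%N.
  have dE (m : 'X_{1..n}) (k : 'I_n) : d m k = m k by rewrite /d valK.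
  have dB m : m \in msupp p -> forall j, (d m j < B)%N.
    move=> sm j; rewrite /d; case: insub => [k|]; first exact: lt_B.
    exact: leq_ltn_trans (lt_B _ i sm).
  rewrite -!dE; apply: (@base_digits_inj B n); [exact: dB|exact: dB| |by []].
  by under eq_bigr do rewrite dE; under [RHS]eq_bigr do rewrite dE.
have f0 : f != 0.
  apply/eqP => /(congr1 (fun h : {poly K} => h`_(code (mlead p)))).
  rewrite coef0 coef_sum (bigD1_seq (mlead p)) ?mlead_supp ?msupp_uniq //=.
  rewrite big_seq_cond big1 => [|m /andP [sm ne]]; last first.
    rewrite coefZ coefXn; case: eqP => [/esym E|_]; last by rewrite mulr0.
    by rewrite (code_inj _ _ sm (mlead_supp p0) E) eqxx in ne.
  rewrite coefZ coefXn eqxx mulr1 addr0 => /eqP.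
  by rewrite mleadc_eq0 (negPf p0).
have [x fx] := poly_nonroot hK f0.
exists (fun i => x ^+ (B ^ i)); move: fx; rewrite mevalE /f horner_sum.
congr (_ != 0); apply: eq_bigr => m _; rewrite hornerZ hornerXn; congr (_ * _).
rewrite expr_sum; apply: eq_bigr => i _; by rewrite -exprM mulnC.
Qed.

(** A nonzero polynomial does not vanish identically on a curve through the
    origin whose velocity [y] avoids the zero set of its lowest homogeneous
    part: that part, evaluated at [y], is the first nonzero Taylor coefficient
    along the curve. No derivative of the polynomial is taken, so the
    characteristic of the field is irrelevant. *)
Lemma nonvanishing_along_curves (K : fieldType) (n : nat) (q : {mpoly K[n]}) :
    infinite_type K -> q != 0 ->
  exists y : 'I_n -> K, forall (w : 'I_n -> {poly K}) (g : {poly K}),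
    (forall i, (w i).[0] = y i) -> g != 0 ->
    exists2 t, q.@[fun i => t * (w i).[t]] != 0 & g.[t] != 0.
Proof.
move=> hK q0.
have [m0 s0 minm0] : exists2 m0, m0 \in msupp q &
    forall m, m \in msupp q -> (mdeg m0 <= mdeg m)%N.
  have ex : exists k, has (fun m => mdeg m == k) (msupp q).
    by exists (mdeg (mlead q)); apply/hasP; exists (mlead q); rewrite ?mlead_supp.
  have /hasP [m0 s0 /eqP E] := xchooseP ex.
  case: (ex_minnP ex) => k /hasP [m1 s1 /eqP Em1] mink.
  exists m1 => // m sm; rewrite Em1; apply: mink; apply/hasP.
  by exists m.
pose d := mdeg m0.
have h0 : pihomog (@mdeg n) d q != 0.
  apply/eqP => /(congr1 (mcoeff m0)); rewrite pihomogE mcoeff0 raddf_sum /=.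
  rewrite big_mkcond (bigD1_seq m0) ?msupp_uniq //= eqxx big1 => [|m ne].
    rewrite mcoeffZ mcoeffX eqxx mulr1 addr0 => /eqP.
    by rewrite mcoeff_eq0 s0.
  by case: ifP => // _; rewrite mcoeffZ mcoeffX (negPf ne) mulr0.
have [y hy] := mpoly_nonroot hK h0; exists y => w g wy g0.
pose G : {poly K} := \sum_(m <- msupp q)
  q@_m *: ('X^(mdeg m - d) * \prod_i (w i) ^+ m i).
have G0 : G != 0.
  apply: contraNneq hy => G0; move: (congr1 (horner^~ 0) G0).
  rewrite horner0 => <-; rewrite /G horner_sum pihomogE raddf_sum /= big_mkcond.
  apply/eqP; rewrite [LHS]big_seq [RHS]big_seq; apply: eq_bigr => m sm.
  rewrite hornerZ hornerM hornerXn horner_prod.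
  case: eqP => [Em|ne]; last first.
    rewrite expr0n subn_eq0 leqNgt ltn_neqAle minm0 // andbT.
    by rewrite eq_sym (introF eqP ne) mul0r mulr0.
  rewrite Em subnn expr0 mul1r mevalZ mevalX; congr (_ * _).
  by apply: eq_bigr => i _; rewrite horner_exp wy.
have [|t] := @poly_nonroot _ ('X^d * G * g) hK.
  by rewrite !mulf_neq0 // -size_poly_eq0 size_polyXn.
rewrite !hornerM !mulf_eq0 !negb_or -andbA => /and3P [td tG tg]; exists t => //.
suff -> : q.@[fun i => t * (w i).[t]] = ('X^d).[t] * G.[t] by rewrite mulf_neq0.
rewrite mevalE /G horner_sum big_distrr /= big_seq [RHS]big_seq.
apply: eq_bigr => m sm; rewrite hornerZ hornerM !hornerXn horner_prod mulrCA.
congr (_ * _); rewrite mulrA -exprD subnKC ?minm0 // mdegE -prodrXr.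
rewrite -big_split; apply: eq_bigr => i _ /=; by rewrite exprMn horner_exp.
Qed.

Lemma poly_tail (R : nzRingType) (c : {poly R}) :
  exists2 w : {poly R}, c = (c`_0)%:P + 'X * w & w`_0 = c`_1.
Proof.
elim/poly_ind: c => [|q a _]; first by exists 0; rewrite ?coef0 ?mulr0 ?addr0.
exists q; rewrite !coefD !coefMX !coefC /= ?add0r ?addr0 //.
by rewrite addrC commr_polyX.
Qed.

(** After a translation, the curve may pass through any point [s]. Only its first
    order jet is constrained, so a polynomial map whose differential at one point
    is onto has an image on which no nonzero polynomial vanishes. *)
Lemma nonvanishing_along_jets (K : fieldType) (n : nat) (p : {mpoly K[n]})
    (s : 'I_n -> K) :
    infinite_type K -> p != 0 ->
  exists y : 'I_n -> K, forall (c : 'I_n -> {poly K}) (g : {poly K}),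
    (forall i, (c i)`_0 = s i) -> (forall i, (c i)`_1 = y i) -> g != 0 ->
    exists2 t, p.@[fun i => (c i).[t]] != 0 & g.[t] != 0.
Proof.
move=> hK p0; pose q := p \mPo [tuple ('X_i + (s i)%:MP)%R | i < n].
have qE v : q.@[v] = p.@[fun i => v i + s i].
  rewrite comp_mpoly_meval; apply: meval_eq => i.
  by rewrite tnth_mktuple mevalD mevalXU mevalC.
have q0 : q != 0.
  have [v pv] := mpoly_nonroot hK p0; apply: contraNneq pv => q0.
  have := qE (fun i => v i - s i); rewrite q0 meval0 => ->.
  by apply/eqP; apply: meval_eq => i; rewrite subrK.
have [y hy] := nonvanishing_along_curves hK q0; exists y => c g c0 c1 g0.
have [w cw wy] : exists2 w : 'I_n -> {poly K},
    (forall i, c i = (s i)%:P + 'X * w i) & (forall i, (w i).[0] = y i).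
  have /fin_all_exists2 [w h1 h2] := fun i => poly_tail (c i).
  exists w => i; first by rewrite {1}h1 c0.
  by rewrite horner_coef0 h2 c1.
have [t pt gt] := hy w g wy g0; exists t => //; move: pt; rewrite qE.
congr (_ != 0); apply: meval_eq => i.
by rewrite cw hornerD hornerC hornerM hornerX addrC.
Qed.

(** * Polynomial maps into a space of larger dimension *)

Lemma msizeM_bound (K : fieldType) (n k l : nat) (p q : {mpoly K[n]}) :
  (msize p <= k.+1)%N -> (msize q <= l.+1)%N -> (msize (p * q) <= (k + l).+1)%N.
Proof.
have [->|p0] := eqVneq p 0; first by rewrite mul0r msize0.
have [->|q0] := eqVneq q 0; first by rewrite mulr0 msize0.
rewrite msizeM //; move: (msize p) (msize q) => a b; lia.
Qed.

Lemma msize_exp_bound (K : fieldType) (n k e : nat) (p : {mpoly K[n]}) :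
  (msize p <= k.+1)%N -> (msize (p ^+ e) <= (k * e).+1)%N.
Proof.
move=> pk; elim: e => [|e IHe]; first by rewrite expr0 msize1 muln0.
by rewrite exprS mulnS msizeM_bound.
Qed.

Lemma msize_prod_bound (K : fieldType) (n k M : nat) (F : 'I_M -> {mpoly K[n]}) :
  (forall i, msize (F i) <= k.+1)%N -> (msize (\prod_i F i) <= (M * k).+1)%N.
Proof.
elim: M F => [|M IHM] F Fk; first by rewrite big_ord0 msize1 mul0n.
by rewrite big_ord_recl mulSn msizeM_bound // IHM.
Qed.

Lemma card_bmultinom_le (n b : nat) : (#|{: 'X_{1..n < b}}| <= b ^ n)%N.
Proof.
have lt_b (m : 'X_{1..n < b}) i : (m i < b)%N.
  by apply: leq_ltn_trans (bmdeg m); rewrite mdegE (bigD1 i) //= leq_addr.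
pose g (m : 'X_{1..n < b}) : {ffun 'I_n -> 'I_b} := [ffun i => Ordinal (lt_b m i)].
have g_inj : injective g.
  move=> m1 m2 /ffunP E; apply: val_inj; apply/mnmP => i.
  by have := E i; rewrite !ffunE => -[].
by have := leq_card g g_inj; rewrite card_ffun !card_ord.
Qed.

Lemma exists_left_kernel (K : fieldType) (m n : nat) (A : 'M[K]_(m, n)) :
  (n < m)%N -> exists2 v : 'rV[K]_m, v != 0 & v *m A = 0.
Proof.
move=> lt_nm; have /rowV0Pn [v /sub_kermxP vA v0] : kermx A != 0.
  by rewrite kermx_eq0 /row_free neq_ltn (leq_ltn_trans (rank_leq_col A)).
by exists v.
Qed.

(** Dimension count: more than [N] polynomials in [N] variables are
    algebraically dependent. There are [D ^ M] products of their powers with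
    exponents below [D], and these lie in the span of about [(M e D) ^ N]
    monomials, which is less once [M > N] and [D] is large. *)
Lemma polynomial_map_not_dominant (K : fieldType) (M N : nat)
    (f : 'I_M -> {mpoly K[N]}) :
    (N < M)%N ->
  exists2 p : {mpoly K[M]}, p != 0 &
    forall v : 'I_N -> K, p.@[fun i => (f i).@[v]] = 0.
Proof.
move=> lt_NM; pose e := (\max_i msize (f i))%N.
pose D := ((M * e).+1 ^ N).+1; pose B := (M * (e * D)).+1.
pose fpow (a : {ffun 'I_M -> 'I_D}) := \prod_i f i ^+ a i.
have fpowB a : (msize (fpow a) <= B)%N.
  apply: msize_prod_bound => i.
  apply: leq_trans (msize_exp_bound (k := e) _ _) _.
    by rewrite leqW // /e (bigD1 i) //= leq_maxl.
  by rewrite ltnS leq_mul // ltnW.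
pose A := \matrix_(a < #|{: {ffun 'I_M -> 'I_D}}|, m < #|{: 'X_{1..N < B}}|)
  (fpow (enum_val a))@_(enum_val m : 'X_{1..N < B}).
have [|v v0 vA] := @exists_left_kernel _ _ _ A.
  apply: leq_ltn_trans (card_bmultinom_le N B) _.
  rewrite card_ffun !card_ord.
  apply: (@leq_ltn_trans (((M * e).+1 * D) ^ N)).
    have leB : (B <= (M * e).+1 * D)%N by rewrite /B mulnA mulSn -add1n leq_add2r.
    by elim: (N) => // k IHk; rewrite !expnS leq_mul.
  rewrite expnMn; apply: (@leq_trans (D * D ^ N)).
    by rewrite ltn_pmul2r // expn_gt0.
  by rewrite -expnS leq_pexp2l.
pose mon (a : {ffun 'I_M -> 'I_D}) := [multinom (a i : nat) | i < M].
have mon_inj : injective mon.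
  move=> a1 a2 /mnmP E; apply/ffunP => i; apply: val_inj.
  by have := E i; rewrite !mnmE.
pose p : {mpoly K[M]} := \sum_a v 0 a *: 'X_[mon (enum_val a)].
exists p => [|u].
  have [a va] : exists a, v 0 a != 0.
    apply/existsP; apply: contraNT v0 => /existsPn va0.
    by apply/eqP/rowP => a; rewrite mxE; apply/eqP; rewrite -[_ == _]negbK va0.
  apply: contraNneq va => /(congr1 (mcoeff (mon (enum_val a)))).
  rewrite mcoeff0 raddf_sum /= (bigD1 a) //= big1 => [|b ne].
    by rewrite mcoeffZ mcoeffX eqxx mulr1 addr0 => ->.
  rewrite mcoeffZ mcoeffX; case: eqP => [/mon_inj/enum_val_inj E|_].
    by rewrite E eqxx in ne.
  by rewrite mulr0.
have pf : \sum_a v 0 a *: fpow (enum_val a) = 0.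
  apply/mpolyP => m; rewrite mcoeff0 raddf_sum /=.
  case: (ltnP (mdeg m) B) => [mB|Bm]; last first.
    apply: big1 => a _; rewrite mcoeffZ memN_msupp_eq0 ?mulr0 //.
    by rewrite msize_mdeg_ge // (leq_trans (fpowB _)).
  have := congr1 (fun r : 'rV_#|_| => r 0 (enum_rank (BMultinom mB))) vA.
  rewrite !mxE => vAm; rewrite -[RHS]vAm; apply: eq_bigr => a _.
  by rewrite !mxE enum_rankK mcoeffZ.
have := congr1 (meval u) pf; rewrite meval0 raddf_sum /= => E.
rewrite -[RHS]E /p raddf_sum; apply: eq_bigr => a _ /=.
rewrite !mevalZ mevalX /fpow rmorph_prod; congr (_ * _).
by apply: eq_bigr => i _; rewrite mnmE rmorphXn.
Qed.

(** * Trilinear action of matrices on three-dimensional arrays *)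

Notation cube R a b c := ('I_a -> 'I_b -> 'I_c -> R).

(** The action of three matrices on a tensor, over an arbitrary commutative
    ring: it is used with scalars, with univariate polynomials (curves of
    tensors) and with multivariate polynomials (generic tensors). *)
Definition tact (R : comNzRingType) (m1 m2 m3 n1 n2 n3 : nat)
    (A : 'M[R]_(m1, n1)) (B : 'M[R]_(m2, n2)) (C : 'M[R]_(m3, n3))
    (T : cube R n1 n2 n3) : cube R m1 m2 m3 :=
  fun a b c => \sum_i \sum_j \sum_k A a i * B b j * C c k * T i j k.

Definition diag_cube (R : comNzRingType) (r : nat) : cube R r r r :=
  fun a b c => ((a == b) && (b == c))%:R.

Lemma sum_delta (R : pzRingType) (I : finType) (i : I) (F : I -> R) :
  \sum_j (i == j)%:R * F j = F i.
Proof.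
rewrite (bigD1 i) //= eqxx mul1r big1 ?addr0 // => j /negPf ne.
by rewrite eq_sym ne mul0r.
Qed.

Lemma tact_ext (R : comNzRingType) (m1 m2 m3 n1 n2 n3 : nat)
    (A : 'M[R]_(m1, n1)) (B : 'M[R]_(m2, n2)) (C : 'M[R]_(m3, n3))
    (S T : cube R n1 n2 n3) a b c :
  (forall i j k, S i j k = T i j k) -> tact A B C S a b c = tact A B C T a b c.
Proof.
by move=> E; do 3!(apply: eq_bigr => ? _); rewrite E.
Qed.

Lemma tactD (R : comNzRingType) (m1 m2 m3 n1 n2 n3 : nat)
    (A : 'M[R]_(m1, n1)) (B : 'M[R]_(m2, n2)) (C : 'M[R]_(m3, n3))
    (S T : cube R n1 n2 n3) a b c :
  tact A B C (fun i j k => S i j k + T i j k) a b c =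
  tact A B C S a b c + tact A B C T a b c.
Proof.
rewrite -big_split; apply: eq_bigr => i _; rewrite -big_split.
apply: eq_bigr => j _; rewrite -big_split; apply: eq_bigr => k _ /=.
by rewrite mulrDr.
Qed.

Lemma tactN (R : comNzRingType) (m1 m2 m3 n1 n2 n3 : nat)
    (A : 'M[R]_(m1, n1)) (B : 'M[R]_(m2, n2)) (C : 'M[R]_(m3, n3))
    (T : cube R n1 n2 n3) a b c :
  tact A B C (fun i j k => - T i j k) a b c = - tact A B C T a b c.
Proof.
rewrite -sumrN; apply: eq_bigr => i _; rewrite -sumrN.
by apply: eq_bigr => j _; rewrite -sumrN; apply: eq_bigr => k _; rewrite mulrN.
Qed.

Lemma tact_id (R : comNzRingType) (r1 r2 r3 : nat) (T : cube R r1 r2 r3) a b c :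
  tact 1%:M 1%:M 1%:M T a b c = T a b c.
Proof.
transitivity (\sum_i (a == i)%:R * T i b c); last exact: sum_delta.
apply: eq_bigr => i _.
transitivity (\sum_j (b == j)%:R * ((a == i)%:R * T i j c)).
  apply: eq_bigr => j _.
  transitivity (\sum_k (c == k)%:R * ((b == j)%:R * ((a == i)%:R * T i j k))).
    by apply: eq_bigr => k _; rewrite !mxE; ring.
  by rewrite sum_delta.
by rewrite sum_delta.
Qed.

Lemma tact_comp (R : comNzRingType) (l1 l2 l3 m1 m2 m3 n1 n2 n3 : nat)
    (A : 'M[R]_(l1, m1)) (B : 'M[R]_(l2, m2)) (C : 'M[R]_(l3, m3))
    (A' : 'M[R]_(m1, n1)) (B' : 'M[R]_(m2, n2)) (C' : 'M[R]_(m3, n3))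
    (T : cube R n1 n2 n3) a b c :
  tact A B C (tact A' B' C' T) a b c =
  tact (A *m A') (B *m B') (C *m C') T a b c.
Proof.
rewrite /tact pair_bigA pair_bigA [RHS]pair_bigA [RHS]pair_bigA /=.
under eq_bigr => x _ do rewrite pair_bigA pair_bigA big_distrr.
rewrite exchange_big; apply: eq_bigr => y _ /=.
rewrite !mxE big_distrlr pair_bigA big_distrlr pair_bigA big_distrl /=.
by apply: eq_bigr => x _ /=; ring.
Qed.

Lemma tact_rmorph (R S : comNzRingType) (f : {rmorphism R -> S})
    (m1 m2 m3 n1 n2 n3 : nat) (A : 'M[R]_(m1, n1)) (B : 'M[R]_(m2, n2))
    (C : 'M[R]_(m3, n3)) (T : cube R n1 n2 n3) a b c :
  f (tact A B C T a b c) =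
  tact (map_mx f A) (map_mx f B) (map_mx f C) (fun i j k => f (T i j k)) a b c.
Proof.
rewrite rmorph_sum; apply: eq_bigr => i _; rewrite rmorph_sum.
apply: eq_bigr => j _; rewrite rmorph_sum; apply: eq_bigr => k _.
by rewrite !mxE !rmorphM.
Qed.

Lemma tact_diag (R : comNzRingType) (m1 m2 m3 r : nat) (A : 'M[R]_(m1, r))
    (B : 'M[R]_(m2, r)) (C : 'M[R]_(m3, r)) a b c :
  tact A B C (@diag_cube R r) a b c = \sum_j A a j * B b j * C c j.
Proof.
apply: eq_bigr => i _.
transitivity (\sum_j (i == j)%:R * (A a i * B b j * C c j)); last first.
  exact: sum_delta.
apply: eq_bigr => j _.
transitivity (\sum_k (j == k)%:R * ((i == j)%:R * (A a i * B b j * C c k))).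
  apply: eq_bigr => k _; rewrite /diag_cube.
  by case: (i == j); case: (j == k); rewrite /= ?mulr1 ?mul1r ?mulr0 ?mul0r ?mulr0.
exact: sum_delta.
Qed.

Lemma tensor_mapE (K : fieldType) (m1 m2 m3 n1 n2 n3 : nat)
    (A : 'M[K]_(m1, n1)) (B : 'M[K]_(m2, n2)) (C : 'M[K]_(m3, n3))
    (T : tensor K n1 n2 n3) a b c :
  tensor_map A B C T (a, b, c) = tact A B C (fun i j k => T (i, j, k)) a b c.
Proof.
rewrite ffunE /tact pair_bigA pair_bigA /=.
by apply: eq_bigr => -[[i j] k] _.
Qed.

Lemma unit_tensorE (K : fieldType) (s : nat) (a b c : 'I_s) :
  unit_tensor K s (a, b, c) = @diag_cube K s a b c.
Proof.
rewrite /unit_tensor sum_ffunE /diag_cube.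
transitivity (\sum_j (a == j)%:R * ((b == j)%:R * (c == j)%:R) : K).
  by apply: eq_bigr => j _; rewrite ffunE !mxE !eqxx !andbT mulrA.
rewrite sum_delta (eq_sym b) (eq_sym c).
by case: eqP => [->|_]; rewrite ?mul1r ?mul0r.
Qed.

Lemma restricts_unitP (K : fieldType) (s n1 n2 n3 : nat) (T : tensor K n1 n2 n3) :
  restricts (unit_tensor K s) T <->
  exists (A : 'M[K]_(s, n1)) (B : 'M[K]_(s, n2)) (C : 'M[K]_(s, n3)),
    forall a b c, tact A B C (fun i j k => T (i, j, k)) a b c = @diag_cube K s a b c.
Proof.
split=> -[A [B [C E]]]; exists A, B, C.
  by move=> a b c; rewrite -tensor_mapE E unit_tensorE.
by apply/ffunP => -[[a b] c]; rewrite tensor_mapE E unit_tensorE.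
Qed.

(** * The parametrization of tensors of given subrank *)

(** When [A_t *m E_t = 1], the action of [A1], [A2], [A3] sends [assemble] to [D],
    whatever [S] is, and every tensor sent to [D] is of this form. With [E_t]
    selecting the rows of a block, it is the tensor that agrees with [S] outside
    the block and whose block is solved for in terms of the other data, so that
    a tensor with prescribed image [D] is parametrized polynomially. *)
Definition assemble (R : comNzRingType) (n r : nat) (E1 E2 E3 : 'M[R]_(n, r))
    (A1 A2 A3 : 'M[R]_(r, n)) (D : cube R r r r) (S : cube R n n n) :
    cube R n n n :=
  fun i j k => S i j k
    + tact E1 E2 E3 (fun a b c => D a b c - tact A1 A2 A3 S a b c) i j k.

Lemma assemble_rmorph (R S : comNzRingType) (f : {rmorphism R -> S})
    (n r : nat) (E1 E2 E3 : 'M[R]_(n, r)) (A1 A2 A3 : 'M[R]_(r, n))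
    (D : cube R r r r) (T : cube R n n n) i j k :
  f (assemble E1 E2 E3 A1 A2 A3 D T i j k) =
  assemble (map_mx f E1) (map_mx f E2) (map_mx f E3)
    (map_mx f A1) (map_mx f A2) (map_mx f A3)
    (fun a b c => f (D a b c)) (fun i j k => f (T i j k)) i j k.
Proof.
rewrite rmorphD tact_rmorph; congr (_ + _); apply: tact_ext => a b c.
by rewrite rmorphB tact_rmorph.
Qed.

Lemma tact_assemble (R : comNzRingType) (n r : nat) (E1 E2 E3 : 'M[R]_(n, r))
    (A1 A2 A3 : 'M[R]_(r, n)) (D : cube R r r r) (S : cube R n n n) a b c :
    A1 *m E1 = 1%:M -> A2 *m E2 = 1%:M -> A3 *m E3 = 1%:M ->
  tact A1 A2 A3 (assemble E1 E2 E3 A1 A2 A3 D S) a b c = D a b c.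
Proof.
move=> AE1 AE2 AE3; rewrite /assemble tactD tact_comp AE1 AE2 AE3 tact_id.
by rewrite addrC subrK.
Qed.

Lemma assemble_complete (R : comNzRingType) (n r : nat) (E1 E2 E3 : 'M[R]_(n, r))
    (A1 A2 A3 : 'M[R]_(r, n)) (W D : cube R r r r) (T : cube R n n n) i j k :
    A1 *m E1 = 1%:M -> A2 *m E2 = 1%:M -> A3 *m E3 = 1%:M ->
    (forall a b c, tact A1 A2 A3 T a b c = D a b c) ->
  assemble E1 E2 E3 A1 A2 A3 D
    (fun i j k => T i j k - tact E1 E2 E3 W i j k) i j k = T i j k.
Proof.
move=> AE1 AE2 AE3 TD; rewrite /assemble -[RHS](subrK (tact E1 E2 E3 W i j k)).
congr (_ + _); apply: tact_ext => a b c.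
rewrite tactD TD tactN tact_comp AE1 AE2 AE3 tact_id; ring.
Qed.

Definition select_mx (R : comNzRingType) (n r : nat) (s : 'I_r -> 'I_n) :
  'M[R]_(n, r) := \matrix_(i, a) (s a == i)%:R.

Lemma mulmx_select (R : comNzRingType) (m n r : nat) (A : 'M[R]_(m, n))
    (s : 'I_r -> 'I_n) a b :
  (A *m select_mx R s) a b = A a (s b).
Proof.
rewrite mxE -[RHS](sum_delta (s b) (A a)).
by apply: eq_bigr => i _; rewrite mxE mulrC.
Qed.

Lemma select_tr_mul (R : comNzRingType) (n r : nat) (s : 'I_r -> 'I_n) :
  injective s -> (select_mx R s)^T *m select_mx R s = 1%:M.
Proof.
move=> s_inj; apply/matrixP => a b.
by rewrite mulmx_select !mxE (inj_eq s_inj).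
Qed.

Lemma tact_select_tr (R : comNzRingType) (n r : nat) (s1 s2 s3 : 'I_r -> 'I_n)
    (T : cube R n n n) a b c :
  tact (select_mx R s1)^T (select_mx R s2)^T (select_mx R s3)^T T a b c =
  T (s1 a) (s2 b) (s3 c).
Proof.
rewrite -[RHS](sum_delta (s1 a) (fun i => T i (s2 b) (s3 c))).
apply: eq_bigr => i _; rewrite -(sum_delta (s2 b) (fun j => T i j (s3 c))).
rewrite big_distrr /=; apply: eq_bigr => j _; rewrite -(sum_delta (s3 c)).
by rewrite !big_distrr /=; apply: eq_bigr => k _; rewrite !mxE !mulrA.
Qed.

Lemma full_rank_minor (K : fieldType) (r n : nat) (A : 'M[K]_(r, n)) :
    row_free A ->
  exists2 s : {ffun 'I_r -> 'I_n}, injective s & A *m select_mx K s \in unitmx.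
Proof.
move=> fA; have fAt : row_full A^T by rewrite -col_leq_rank mxrank_tr row_leq_rank.
have [f f_inj uf] : exists2 f : 'I_r -> 'I_n, injective f & rowsub f A^T \in unitmx.
  by exists (fullrankfun fAt); [apply: fullrankfun_inj|apply: fullrowsub_unit].
exists [ffun a => f a]; first by move=> a b; rewrite !ffunE => /f_inj.
rewrite -unitmx_tr; congr (_ \in unitmx): uf.
by apply/matrixP => a b; rewrite [RHS]mxE mulmx_select !mxE ffunE.
Qed.

(** The unit tensor is concise: a row vector killing one of the three matrices
    would be a linear relation between its slices. *)
Lemma tact_row_free (K : fieldType) (s n1 n2 n3 : nat) (A : 'M[K]_(s, n1))
    (B : 'M[K]_(s, n2)) (C : 'M[K]_(s, n3)) (T : cube K n1 n2 n3) :
    (forall a b c, tact A B C T a b c = diag_cube K a b c) ->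
  [/\ row_free A, row_free B & row_free C].
Proof.
move=> TD; split; apply: inj_row_free => v vA; apply/rowP => a; rewrite mxE.
- transitivity (tact v 1%:M 1%:M (tact A B C T) 0 a a); last first.
    by rewrite tact_comp vA; do 3!(apply: big1 => ? _); rewrite mxE !mul0r.
  rewrite (tact_ext _ _ _ (T := @diag_cube K s)) // tact_diag.
  rewrite -[LHS](sum_delta a (v 0)); apply: eq_bigr => j _; rewrite !mxE.
  by case: (a == j); rewrite /= ?mulr1 ?mul1r ?mulr0 ?mul0r.
- transitivity (tact 1%:M v 1%:M (tact A B C T) a 0 a); last first.
    by rewrite tact_comp vA; do 3!(apply: big1 => ? _); rewrite !mxE mulr0 !mul0r.
  rewrite (tact_ext _ _ _ (T := @diag_cube K s)) // tact_diag.
  rewrite -[LHS](sum_delta a (v 0)); apply: eq_bigr => j _; rewrite !mxE.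
  by case: (a == j); rewrite /= ?mulr1 ?mul1r ?mulr0 ?mul0r.
- transitivity (tact 1%:M 1%:M v (tact A B C T) a a 0); last first.
    by rewrite tact_comp vA; do 3!(apply: big1 => ? _); rewrite !mxE mulr0 !mul0r.
  rewrite (tact_ext _ _ _ (T := @diag_cube K s)) // tact_diag.
  rewrite -[LHS](sum_delta a (v 0)); apply: eq_bigr => j _; rewrite !mxE.
  by case: (a == j); rewrite /= ?mulr1 ?mul1r ?mulr0 ?mul0r.
Qed.

Lemma unitmx_col_neq0 (K : fieldType) (r : nat) (G : 'M[K]_r) (j : 'I_r) :
  G \in unitmx -> exists k, G k j != 0.
Proof.
move=> uG; apply/existsP; apply: contraT => /existsPn G0.
have /eqP := congr1 (fun M : 'M_r => M j j) (mulVmx uG).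
rewrite !mxE eqxx big1 ?(eq_sym 0) ?oner_eq0 // => k _.
by have := G0 k; rewrite negbK => /eqP ->; rewrite mulr0.
Qed.

(** Every tensor restricting to the unit tensor is assembled from a block of
    [r] rank one tensors, from matrices whose chosen minors are identities and
    from a tensor vanishing on the chosen block. Rescaling the vectors of each
    rank one tensor normalizes one coordinate in two of its three factors: this
    is the torus that stabilizes the unit tensor. *)
Lemma restricts_unit_assemble (K : fieldType) (n r : nat) (T : tensor K n n n) :
    restricts (unit_tensor K r) T ->
  exists (s1 s2 s3 : {ffun 'I_r -> 'I_n}) (k1 k2 : {ffun 'I_r -> 'I_r}),
    [/\ injective s1, injective s2 & injective s3] /\
  exists (g1 g2 g3 : 'M[K]_r) (A1 A2 A3 : 'M[K]_(r, n)) (S : cube K n n n),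
    [/\ forall j, g1 (k1 j) j = 1, forall j, g2 (k2 j) j = 1,
        [/\ A1 *m select_mx K s1 = 1%:M, A2 *m select_mx K s2 = 1%:M
          & A3 *m select_mx K s3 = 1%:M],
        forall a b c, S (s1 a) (s2 b) (s3 c) = 0
      & forall i j k, T (i, j, k) =
          assemble (select_mx K s1) (select_mx K s2) (select_mx K s3) A1 A2 A3
            (tact g1 g2 g3 (@diag_cube K r)) S i j k].
Proof.
case/restricts_unitP => [A1 [A2 [A3 TD]]].
have [fA1 fA2 fA3] := tact_row_free TD.
have [s1 i1 u1] := full_rank_minor fA1; have [s2 i2 u2] := full_rank_minor fA2.
have [s3 i3 u3] := full_rank_minor fA3.
pose G1 := invmx (A1 *m select_mx K s1); pose G2 := invmx (A2 *m select_mx K s2).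
pose G3 := invmx (A3 *m select_mx K s3).
have [k1 k1P] : exists k : {ffun 'I_r -> 'I_r}, forall j, G1 (k j) j != 0.
  have uG : G1 \in unitmx by rewrite unitmx_inv.
  have /fin_all_exists [k kP] := fun j => unitmx_col_neq0 j uG.
  by exists [ffun j => k j] => j; rewrite ffunE.
have [k2 k2P] : exists k : {ffun 'I_r -> 'I_r}, forall j, G2 (k j) j != 0.
  have uG : G2 \in unitmx by rewrite unitmx_inv.
  have /fin_all_exists [k kP] := fun j => unitmx_col_neq0 j uG.
  by exists [ffun j => k j] => j; rewrite ffunE.
exists s1, s2, s3, k1, k2; split=> //.
pose E1 := select_mx K s1; pose E2 := select_mx K s2; pose E3 := select_mx K s3.
pose Tc : cube K n n n := fun i j k => T (i, j, k).
have AE1 : G1 *m A1 *m E1 = 1%:M by rewrite -mulmxA mulVmx.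
have AE2 : G2 *m A2 *m E2 = 1%:M by rewrite -mulmxA mulVmx.
have AE3 : G3 *m A3 *m E3 = 1%:M by rewrite -mulmxA mulVmx.
exists (\matrix_(a, j) (G1 a j / G1 (k1 j) j)).
exists (\matrix_(a, j) (G2 a j / G2 (k2 j) j)).
exists (\matrix_(a, j) (G3 a j * G1 (k1 j) j * G2 (k2 j) j)).
exists (G1 *m A1), (G2 *m A2), (G3 *m A3).
exists (fun i j k => Tc i j k - tact E1 E2 E3 (tact E1^T E2^T E3^T Tc) i j k).
split=> // [j|j|a b c|i j k].
- by rewrite mxE divff.
- by rewrite mxE divff.
- rewrite -[LHS](@tact_select_tr K n r s1 s2 s3
    (fun i j k => Tc i j k - tact E1 E2 E3 (tact E1^T E2^T E3^T Tc) i j k)).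
  by rewrite tactD tactN tact_comp /E1 /E2 /E3 !select_tr_mul // tact_id subrr.
- rewrite assemble_complete // => a b c.
  rewrite -tact_comp (tact_ext _ _ _ (T := @diag_cube K r)); last exact: TD.
  rewrite !tact_diag; apply: eq_bigr => l _; rewrite !mxE.
  by field; rewrite k1P k2P.
Qed.

(** * The upper bound: a parameter count *)

Definition mode (t : nat) (lt3 : (t < 3)%N) : 'I_3 := Ordinal lt3.
Notation mode1 := (@mode 0 isT).
Notation mode2 := (@mode 1 isT).
Notation mode3 := (@mode 2 isT).

Definition by_mode (T : Type) (x y z : T) (t : 'I_3) : T := nth x [:: x; y; z] t.

Notation params n r :=
  ('I_3 * 'I_r * 'I_r + 'I_3 * 'I_r * 'I_n + 'I_n * 'I_n * 'I_n)%type.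

Definition factor_of (R : comNzRingType) (n r : nat) (x : params n r -> R) t :
  'M[R]_r := \matrix_(a, j) x (inl (inl (t, a, j))).

Definition rows_of (R : comNzRingType) (n r : nat) (x : params n r -> R) t :
  'M[R]_(r, n) := \matrix_(a, i) x (inl (inr (t, a, i))).

Definition param_map (R : comNzRingType) (n r : nat) (s : 'I_3 -> 'I_r -> 'I_n)
    (x : params n r -> R) : cube R n n n :=
  assemble (select_mx R (s mode1)) (select_mx R (s mode2)) (select_mx R (s mode3))
    (rows_of x mode1) (rows_of x mode2) (rows_of x mode3)
    (tact (factor_of x mode1) (factor_of x mode2) (factor_of x mode3)
       (@diag_cube R r))
    (fun i j k => x (inr (i, j, k))).

Lemma param_map_rmorph (R S : comNzRingType) (f : {rmorphism R -> S})
    (n r : nat) (s : 'I_3 -> 'I_r -> 'I_n) (x : params n r -> R) i j k :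
  f (param_map s x i j k) = param_map s (f \o x) i j k.
Proof.
have sel t : map_mx f (select_mx R (s t)) = select_mx S (s t).
  by apply/matrixP => a b; rewrite !mxE rmorph_nat.
have row t : map_mx f (rows_of x t) = rows_of (f \o x) t.
  by apply/matrixP => a b; rewrite !mxE.
have fac t : map_mx f (factor_of x t) = factor_of (f \o x) t.
  by apply/matrixP => a b; rewrite !mxE.
rewrite assemble_rmorph !sel !row; congr (_ + _); apply: tact_ext => a b c.
rewrite tact_rmorph !fac; congr (_ - _); apply: tact_ext => a' b' c'.
by rewrite rmorph_nat.
Qed.

(** Indices of the normalizations: one coordinate in each column of the first two
    factor matrices (torus), the chosen minors (change of basis), the block (its
    entries are determined by the rest). *)
Notation frozen r :=
  (('I_r + 'I_r) + 'I_3 * 'I_r * 'I_r + 'I_r * 'I_r * 'I_r)%type.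

Definition frozen_param (n r : nat) (s : 'I_3 -> 'I_r -> 'I_n)
    (k1 k2 : 'I_r -> 'I_r) (z : frozen r) : params n r :=
  match z with
  | inl (inl (inl j)) => inl (inl (mode1, k1 j, j))
  | inl (inl (inr j)) => inl (inl (mode2, k2 j, j))
  | inl (inr (t, a, b)) => inl (inr (t, a, s t b))
  | inr (a, b, c) => inr (s mode1 a, s mode2 b, s mode3 c)
  end.

Definition frozen_value (K : fieldType) (n r : nat) (s : 'I_3 -> 'I_r -> 'I_n)
    (y : params n r) : K :=
  match y with
  | inl (inl _) => 1
  | inl (inr (t, a, i)) => (s t a == i)%:R
  | inr _ => 0
  end.

Lemma frozen_param_inj (n r : nat) (s : 'I_3 -> 'I_r -> 'I_n) k1 k2 :
  (forall t, injective (s t)) -> injective (frozen_param s k1 k2).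
Proof.
move=> s_inj.
by case=> [[[j|j]|[[t a] b]]|[[a b] c]]; case=> [[[j'|j']|[[t' a'] b']]|[[a' b'] c']] //=;
  case=> //; try (by move=> _ ->); [move=> -> -> | move=> + + +] => /s_inj -> //;
  do 2!move=> /s_inj ->.
Qed.

Lemma card_params (n r : nat) :
  #|{: params n r}| = (3 * r * r + 3 * r * n + n * n * n)%N.
Proof. by rewrite !card_sum !card_prod !card_ord. Qed.

Lemma card_frozen (r : nat) : #|{: frozen r}| = (r + r + 3 * r * r + r * r * r)%N.
Proof. by rewrite !card_sum !card_prod !card_ord. Qed.

(** For [r ^ 2 > 3 n - 2], the free parameters are fewer than the [n ^ 3]
    coordinates of a tensor. *)
Lemma param_image_in_hypersurface (K : fieldType) (n r : nat)
    (s : 'I_3 -> 'I_r -> 'I_n) (k1 k2 : 'I_r -> 'I_r) :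
    (forall t, injective (s t)) -> (3 * n - 2 < r * r)%N ->
  exists2 p : {mpoly K[#|{: 'I_n * 'I_n * 'I_n}|]}, p != 0 &
    forall (T : tensor K n n n) (x : params n r -> K),
      (forall z, x (frozen_param s k1 k2 z)
                 = frozen_value K s (frozen_param s k1 k2 z)) ->
      (forall i j k, T (i, j, k) = param_map s x i j k) ->
      tensor_eval p T = 0.
Proof.
move=> s_inj lt_nr.
pose F := ~: [set frozen_param s k1 k2 z | z : frozen r].
have lt_F : (#|F| < #|{: 'I_n * 'I_n * 'I_n}|)%N.
  have := cardsC [set frozen_param s k1 k2 z | z : frozen r].
  rewrite -/F card_imset; last exact: frozen_param_inj.
  rewrite card_params card_frozen !card_prod !card_ord.
  by nia.
pose xi (y : params n r) : {mpoly K[#|F|]} :=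
  if [pick i : 'I_#|F| | enum_val i == y] is Some i then 'X_i
  else (frozen_value K s y)%:MP.
pose f (m : 'I_#|{: 'I_n * 'I_n * 'I_n}|) : {mpoly K[#|F|]} :=
  let: (i, j, k) := enum_val m in param_map s xi i j k.
have [p p0 pf] := polynomial_map_not_dominant f lt_F.
exists p => // T x x_frozen Tx.
pose v (i : 'I_#|F|) := x (enum_val i).
rewrite -[RHS](pf v) /tensor_eval; apply: meval_eq => m; rewrite /f.
case: (enum_val m) => -[i j] k; rewrite param_map_rmorph Tx.
have xiE y : (xi y).@[v] = x y.
  rewrite /xi; case: pickP => [e /eqP <-|no]; first by rewrite mevalXU.
  rewrite mevalC; case: (boolP (y \in F)) => [yF|].
    by have /eqP[] := no (enum_rank_in yF y); rewrite enum_rankK_in.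
  by rewrite inE negbK => /imsetP [z _ ->]; rewrite x_frozen.
have fac t : factor_of x t = factor_of (meval v \o xi) t.
  by apply/matrixP => a b; rewrite !mxE /= xiE.
have row t : rows_of x t = rows_of (meval v \o xi) t.
  by apply/matrixP => a b; rewrite !mxE /= xiE.
rewrite /param_map /assemble !fac !row /= xiE; congr (_ + _).
apply: tact_ext => a b c; congr (_ - _).
by apply: tact_ext => a' b' c'; rewrite /= xiE.
Qed.

Lemma subrank_ge_restricts (K : fieldType) (n1 n2 n3 r : nat)
    (T : tensor K n1 n2 n3) :
  subrank_ge r T -> restricts (unit_tensor K r) T.
Proof.
case=> s [/restricts_unitP [A [B [C TD]]] _] le_rs; apply/restricts_unitP.
pose P : 'M[K]_(r, s) := \matrix_(a, b) (widen_ord le_rs a == b)%:R.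
exists (P *m A), (P *m B), (P *m C) => a b c; rewrite -tact_comp.
rewrite (tact_ext _ _ _ (T := @diag_cube K s)) // tact_diag /diag_cube.
transitivity (\sum_j (widen_ord le_rs a == j)%:R *
  ((widen_ord le_rs b == j)%:R * (widen_ord le_rs c == j)%:R) : K).
  by apply: eq_bigr => j _; rewrite !mxE mulrA.
rewrite sum_delta -!val_eqE /= [in RHS]eq_sym (eq_sym (val b)) (eq_sym (val c)).
by have [->|_] := eqVneq (val b) (val a); rewrite ?mul0r ?mul1r.
Qed.

(** There are finitely many choices of minors and of normalized coordinates; the
    product of the polynomials attached to them vanishes on all tensors of
    subrank at least [r]. *)
Lemma subrank_ge_not_dense (K : fieldType) (n r : nat) :
    infinite_type K -> (3 * n - 2 < r * r)%N ->
  ~ zariski_dense (fun T : tensor K n n n => subrank_ge r T).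
Proof.
move=> hK lt_nr dense.
pose data := ({ffun 'I_r -> 'I_n} * {ffun 'I_r -> 'I_n} * {ffun 'I_r -> 'I_n}
  * {ffun 'I_r -> 'I_r} * {ffun 'I_r -> 'I_r})%type.
pose smap (d : data) : 'I_3 -> 'I_r -> 'I_n :=
  by_mode (d.1.1.1.1 : 'I_r -> 'I_n) d.1.1.1.2 d.1.1.2.
pose good (d : data) := forall t, injective (smap d t).
pose covers (p : {mpoly K[#|{: 'I_n * 'I_n * 'I_n}|]}) (d : data) :=
  forall (T : tensor K n n n) (x : params n r -> K),
      (forall z, x (frozen_param (smap d) d.1.2 d.2 z)
        = frozen_value K (smap d) (frozen_param (smap d) d.1.2 d.2 z)) ->
      (forall i j k, T (i, j, k) = param_map (smap d) x i j k) ->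
      tensor_eval p T = 0.
have ex_p (d : data) : exists p, p != 0 /\ (good d -> covers p d).
  case: (classic (good d)) => [gd|ngd]; last by exists 1; rewrite oner_neq0.
  have [p p0 pc] := param_image_in_hypersurface K d.1.2 d.2 gd lt_nr.
  by exists p.
have [P PP] := fin_all_exists ex_p.
have P0 : \prod_d P d != 0 by apply/prodf_neq0 => d _; case: (PP d).
have [v] := mpoly_nonroot hK P0; apply/negP; rewrite negbK.
pose Z (T : tensor K n n n) := tensor_eval (\prod_d P d) T = 0.
have ZT : forall T, Z T.
  apply: dense => [|T /subrank_ge_restricts /restricts_unit_assemble].
    exists (eq (\prod_d P d)) => T; split=> [ZT p <- //|]; exact.
  case=> s1 [s2 [s3 [k1 [k2 [[i1 i2 i3] [g1 [g2 [g3 [A1 [A2 [A3 [S]]]]]]]]]]]].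
  case=> g1k g2k [AE1 AE2 AE3] S0 TE.
  pose d : data := (s1, s2, s3, k1, k2).
  rewrite /Z /tensor_eval rmorph_prod (bigD1 d) //=.
  have gd : good d by move=> t; rewrite /smap /by_mode; case: t => -[|[|[|]]].
  pose g t : 'M_r := by_mode g1 g2 g3 t; pose A t : 'M_(r, n) := by_mode A1 A2 A3 t.
  pose x (y : params n r) : K := match y with
    | inl (inl (t, a, j)) => g t a j
    | inl (inr (t, a, i)) => A t a i
    | inr (i, j, k) => S i j k
    end.
  have -> : (P d).@[fun i => T (enum_val i)] = 0; last by rewrite mul0r.
  apply: ((PP d).2 gd T x) => [[[[j|j]|[[t a] b]]|[[a b] c]] | i' j' k'] /=.
  - exact: g1k.
  - exact: g2k.
  - have AE : A t *m select_mx K (smap d t) = 1%:M.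
      by rewrite /A /smap /by_mode; case: t => -[|[|[|]]].
    by rewrite (inj_eq (gd t)) -mulmx_select AE mxE.
  - exact: S0.
  - rewrite TE /param_map /assemble /=; congr (_ + _).
    have AE t : rows_of x t = A t by apply/matrixP => a b; rewrite mxE.
    have gE t : factor_of x t = g t by apply/matrixP => a b; rewrite mxE.
    by rewrite !AE !gE.
pose T : tensor K n n n := [ffun y => v (enum_rank y)].
have := ZT T; rewrite /Z /tensor_eval => E; rewrite -[X in _ == X]E; apply/eqP.
by apply: meval_eq => i; rewrite ffunE enum_valK.
Qed.

(** * Linear systems without nonzero solutions *)

Definition injective_system (K : fieldType) (P X : finType) (l : P -> X -> K) : Prop :=
  forall T : X -> K, (forall p, \sum_x l p x * T x = 0) -> forall x, T x = 0.

Definition system_mx (K : fieldType) (P X : finType) (l : P -> X -> K) :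
  'M[K]_(#|X|, #|P|) := \matrix_(x, p) l (enum_val p) (enum_val x).

Lemma injective_systemP (K : fieldType) (P X : finType) (l : P -> X -> K) :
  injective_system l <-> row_free (system_mx l).
Proof.
split=> [nd|fl T lT].
  apply: inj_row_free => v vl; apply/rowP => x; rewrite mxE.
  rewrite -[x]enum_valK; apply: (nd (fun y => v 0 (enum_rank y))) => p.
  have := congr1 (fun r : 'rV_#|_| => r 0 (enum_rank p)) vl.
  rewrite !mxE => E; rewrite -[RHS]E (reindex_onto enum_val enum_rank) /=.
    apply: eq_big => [y|y _]; first by rewrite enum_valK eqxx.
    by rewrite !mxE enum_rankK enum_valK mulrC.
  by move=> y _; rewrite enum_rankK.
move=> x; have /row_free_inj/(_ (\row_y T (enum_val y)) 0) := fl.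
rewrite mul0mx => T0.
suff /T0/rowP/(_ (enum_rank x)) : (\row_y T (enum_val y)) *m system_mx l = 0.
  by rewrite !mxE enum_rankK.
apply/rowP => p; rewrite !mxE -[RHS](lT (enum_val p)).
rewrite (reindex_onto enum_rank enum_val) /=; last by move=> y _; rewrite enum_valK.
apply: eq_big => [y|y _]; first by rewrite enum_rankK eqxx.
by rewrite !mxE enum_rankK mulrC.
Qed.

(** Fredholm alternative: the transpose of an injective linear map is onto. *)
Lemma injective_system_solve (K : fieldType) (P X : finType) (l : P -> X -> K)
    (W : X -> K) :
  injective_system l -> exists v : P -> K, forall x, \sum_p v p * l p x = W x.
Proof.
move=> /injective_systemP /row_freeP [B lB].
exists (fun p => \sum_y B (enum_rank p) y * W (enum_val y)) => x.
rewrite -[RHS]/(W x) -[in RHS](enum_rankK x).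
rewrite -[RHS](sum_delta (enum_rank x) (fun y => W (enum_val y))).
under eq_bigr do rewrite big_distrl.
rewrite exchange_big; apply: eq_bigr => y _ /=.
have := congr1 (fun r : 'M_#|_| => r (enum_rank x) y) lB.
rewrite !mxE => <-; rewrite big_distrl (reindex_onto enum_rank enum_val) /=.
  apply: eq_big => [p|p _]; first by rewrite enum_rankK eqxx.
  by rewrite !mxE !enum_rankK; ring.
by move=> p _; rewrite enum_valK.
Qed.

Definition pencil (K : fieldType) (P X : finType) (l0 l1 : P -> X -> K) (t : K) :
  P -> X -> K := fun p x => l0 p x + t * l1 p x.

(** The parameter values at which a pencil of systems degenerates are roots of a
    determinant, which is a nonzero polynomial as soon as the pencil is injective
    at [0] or at infinity. This is how two open conditions are met at once. *)
Lemma injective_pencil (K : fieldType) (P X : finType) (l0 l1 : P -> X -> K) :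
    injective_system l0 \/ injective_system l1 ->
  exists2 f : {poly K}, f != 0 &
    forall t, f.[t] != 0 -> injective_system (pencil l0 l1 t).
Proof.
pose A0 := system_mx l0; pose A1 := system_mx l1.
pose f (B : 'M_(#|P|, #|X|)) : {poly K} :=
  \det (map_mx polyC (A0 *m B) + 'X *: map_mx polyC (A1 *m B)).
have fE B t : (f B).[t] = \det ((A0 + t *: A1) *m B).
  rewrite -[LHS]/(horner_eval t (f B)) -det_map_mx; congr (\det _).
  apply/matrixP => x y; rewrite mulmxDl -scalemxAl !mxE /= /horner_eval.
  by rewrite hornerD hornerM hornerX !hornerC.
have ok B t : (f B).[t] != 0 -> injective_system (pencil l0 l1 t).
  rewrite fE => d0; apply/injective_systemP/row_freeP.
  exists (B *m invmx ((A0 + t *: A1) *m B)); rewrite mulmxA.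
  have -> : system_mx (pencil l0 l1 t) = A0 + t *: A1.
    by apply/matrixP => x p; rewrite !mxE.
  by rewrite mulmxV // unitmxE unitfE.
case=> /injective_systemP /row_freeP [B AB]; (exists (f B); last exact: ok).
  apply/eqP => /(congr1 (horner^~ 0)); rewrite fE horner0 scale0r addr0 AB.
  by rewrite det1 => /eqP; rewrite oner_eq0.
have -> : f B = char_poly (- (A0 *m B)); last by rewrite monic_neq0 ?char_poly_monic.
congr (\det _); rewrite /char_poly_mx map_mxN opprK AB addrC; congr (_ + _).
by apply/matrixP => x y; rewrite !mxE; case: (x == y); rewrite ?mulr1 ?mulr0.
Qed.

(** * Families of matrices that separate tensors *)

Definition off_diagonal (K : fieldType) (r : nat) (T : cube K r r r) : Prop :=
  forall a b, [/\ T a b b = 0, T a b a = 0 & T a a b = 0].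

(** Dually: modulo the tensors supported where two indices coincide, the space
    of all tensors is the sum of three subspaces, each the tensor product of
    [K ^ r] in one mode with the span of one family in the two other modes. The
    tensors with three distinct indices form a space of dimension
    [r (r - 1) (r - 2)], so at least [(r - 1) (r - 2)] matrices are needed. *)
Definition separating (K : fieldType) (r d1 d2 d3 : nat)
    (M1 : cube K d1 r r) (M2 : cube K d2 r r) (M3 : cube K d3 r r) : Prop :=
  forall T : cube K r r r, off_diagonal T ->
    (forall s i, \sum_j \sum_k M1 s j k * T i j k = 0) ->
    (forall s j, \sum_i \sum_k M2 s i k * T i j k = 0) ->
    (forall s k, \sum_i \sum_j M3 s i j * T i j k = 0) ->
  forall i j k, T i j k = 0.

Definition separable (K : fieldType) (r d1 d2 d3 : nat) : Prop :=
  exists (M1 : cube K d1 r r) (M2 : cube K d2 r r) (M3 : cube K d3 r r),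
    separating M1 M2 M3.

Notation sep_index r d1 d2 d3 :=
  ('I_r * 'I_r + 'I_r * 'I_r + 'I_r * 'I_r
   + ('I_d1 * 'I_r + 'I_d2 * 'I_r + 'I_d3 * 'I_r))%type.

Definition sep_system (K : fieldType) (r d1 d2 d3 : nat)
    (M1 : cube K d1 r r) (M2 : cube K d2 r r) (M3 : cube K d3 r r)
    (p : sep_index r d1 d2 d3) (x : 'I_r * 'I_r * 'I_r) : K :=
  match p with
  | inl (inl (inl (a, b))) => ((a, b, b) == x)%:R
  | inl (inl (inr (a, b))) => ((a, b, a) == x)%:R
  | inl (inr (a, b)) => ((a, a, b) == x)%:R
  | inr (inl (inl (s, i))) => (i == x.1.1)%:R * M1 s x.1.2 x.2
  | inr (inl (inr (s, j))) => (j == x.1.2)%:R * M2 s x.1.1 x.2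
  | inr (inr (s, k)) => (k == x.2)%:R * M3 s x.1.1 x.1.2
  end.

Lemma sum_triple (R : nmodType) (I J L : finType) (F : I * J * L -> R) :
  \sum_x F x = \sum_i \sum_j \sum_k F (i, j, k).
Proof.
by rewrite pair_bigA pair_bigA /=; apply: eq_bigr => -[[i j] k].
Qed.

Lemma sep_sum1 (R : pzRingType) (I J L : finType) (i : I) (M : J -> L -> R)
    (T : I * J * L -> R) :
  \sum_x (i == x.1.1)%:R * M x.1.2 x.2 * T x = \sum_j \sum_k M j k * T (i, j, k).
Proof.
rewrite sum_triple /=.
rewrite -(sum_delta i (fun i => \sum_j \sum_k M j k * T (i, j, k))).
apply: eq_bigr => i' _; rewrite big_distrr; apply: eq_bigr => j _ /=.
by rewrite big_distrr; apply: eq_bigr => k _ /=; rewrite mulrA.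
Qed.

Lemma sep_sum2 (R : pzRingType) (I J L : finType) (j : J) (M : I -> L -> R)
    (T : I * J * L -> R) :
  \sum_x (j == x.1.2)%:R * M x.1.1 x.2 * T x = \sum_i \sum_k M i k * T (i, j, k).
Proof.
rewrite sum_triple /=; apply: eq_bigr => i _.
rewrite -(sum_delta j (fun j => \sum_k M i k * T (i, j, k))).
apply: eq_bigr => j' _; rewrite big_distrr; apply: eq_bigr => k _ /=.
by rewrite mulrA.
Qed.

Lemma sep_sum3 (R : pzRingType) (I J L : finType) (k : L) (M : I -> J -> R)
    (T : I * J * L -> R) :
  \sum_x (k == x.2)%:R * M x.1.1 x.1.2 * T x = \sum_i \sum_j M i j * T (i, j, k).
Proof.
rewrite sum_triple /=; apply: eq_bigr => i _; apply: eq_bigr => j _.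
rewrite -(sum_delta k (fun k => M i j * T (i, j, k))).
by apply: eq_bigr => k' _; rewrite mulrA.
Qed.

Lemma sep_systemP (K : fieldType) (r d1 d2 d3 : nat)
    (M1 : cube K d1 r r) (M2 : cube K d2 r r) (M3 : cube K d3 r r) :
  separating M1 M2 M3 <-> injective_system (sep_system M1 M2 M3).
Proof.
split=> [sep T lT [[i j] k]|nd T off T1 T2 T3 i j k].
  apply: (sep (fun i j k => T (i, j, k))) => [a b|s i'|s j'|s k'].
  - split; [have := lT (inl (inl (inl (a, b))))|have := lT (inl (inl (inr (a, b))))
      |have := lT (inl (inr (a, b)))]; by rewrite /= sum_delta.
  - by rewrite -[RHS](lT (inr (inl (inl (s, i'))))) /= sep_sum1.
  - by rewrite -[RHS](lT (inr (inl (inr (s, j'))))) /= sep_sum2.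
  - by rewrite -[RHS](lT (inr (inr (s, k')))) /= sep_sum3.
apply: (nd (fun x => T x.1.1 x.1.2 x.2) _ (i, j, k)).
case=> [[[[a b]|[a b]]|[a b]]|[[[s a]|[s a]]|[s a]]] /=.
- by rewrite sum_delta; case: (off a b).
- by rewrite sum_delta; case: (off a b).
- by rewrite sum_delta; case: (off a b).
- exact: etrans (sep_sum1 a (M1 s) (fun x => T x.1.1 x.1.2 x.2)) (T1 s a).
- exact: etrans (sep_sum2 a (M2 s) (fun x => T x.1.1 x.1.2 x.2)) (T2 s a).
- exact: etrans (sep_sum3 a (M3 s) (fun x => T x.1.1 x.1.2 x.2)) (T3 s a).
Qed.

(** * The lower bound: the parametrization is a submersion at some point *)

Lemma restricts_unit_bound (K : fieldType) (s n1 n2 n3 : nat)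
    (T : tensor K n1 n2 n3) :
  restricts (unit_tensor K s) T -> (s <= n1)%N.
Proof.
case/restricts_unitP => A [B [C /tact_row_free [fA _ _]]].
by have := rank_leq_col A; rewrite (eqP fA).
Qed.

(** The subrank exists since sizes of unit tensors below [T] are bounded. *)
Lemma restricts_subrank_ge (K : fieldType) (n1 n2 n3 r : nat)
    (T : tensor K n1 n2 n3) :
  restricts (unit_tensor K r) T -> subrank_ge r T.
Proof.
move=> rT; have [m] := ubnP (n1 - r); elim: m r rT => // m IHm r rT lt_m.
case: (classic (exists2 s, (r < s)%N & restricts (unit_tensor K s) T)).
  case=> s lt_rs sT; have [|s' s'T le_ss'] := IHm s sT.
    by have := restricts_unit_bound sT; lia.
  by exists s' => //; lia.
move=> no; exists r => //; split=> // s sT; rewrite leqNgt; apply/negP => lt_rs.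
by apply: no; exists s.
Qed.

Lemma coef1M (R : nzRingType) (p q : {poly R}) :
  (p * q)`_1 = p`_0 * q`_1 + p`_1 * q`_0.
Proof. by rewrite coefM big_ord_recr big_ord1. Qed.

Lemma tact_coef0 (K : fieldType) (m1 m2 m3 n1 n2 n3 : nat)
    (A : 'M[{poly K}]_(m1, n1)) (B : 'M[{poly K}]_(m2, n2))
    (C : 'M[{poly K}]_(m3, n3)) (T : cube {poly K} n1 n2 n3) a b c :
  (tact A B C T a b c)`_0 =
  tact (map_mx (coefp 0) A) (map_mx (coefp 0) B) (map_mx (coefp 0) C)
    (fun i j k => (T i j k)`_0) a b c.
Proof. exact: (tact_rmorph (coefp 0)). Qed.

(** Leibniz rule. *)
Lemma tact_coef1 (K : fieldType) (m1 m2 m3 n1 n2 n3 : nat)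
    (A : 'M[{poly K}]_(m1, n1)) (B : 'M[{poly K}]_(m2, n2))
    (C : 'M[{poly K}]_(m3, n3)) (T : cube {poly K} n1 n2 n3) a b c :
  let A0 := map_mx (coefp 0) A in let B0 := map_mx (coefp 0) B in
  let C0 := map_mx (coefp 0) C in let T0 := fun i j k => (T i j k)`_0 in
  (tact A B C T a b c)`_1 =
    tact (map_mx (coefp 1) A) B0 C0 T0 a b c
    + tact A0 (map_mx (coefp 1) B) C0 T0 a b c
    + tact A0 B0 (map_mx (coefp 1) C) T0 a b c
    + tact A0 B0 C0 (fun i j k => (T i j k)`_1) a b c.
Proof.
move=> /=; rewrite coef_sum -!big_split; apply: eq_bigr => i _.
rewrite coef_sum -!big_split; apply: eq_bigr => j _.
rewrite coef_sum -!big_split; apply: eq_bigr => k _ /=.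
by rewrite !mxE /= /coefp !coef1M !coef0M; ring.
Qed.

Lemma tact_mx0 (R : comNzRingType) (m1 m2 m3 n1 n2 n3 : nat)
    (A : 'M[R]_(m1, n1)) (B : 'M[R]_(m2, n2)) (C : 'M[R]_(m3, n3))
    (T : cube R n1 n2 n3) a b c :
  [\/ A = 0, B = 0 | C = 0] -> tact A B C T a b c = 0.
Proof.
move=> z; do 3!(apply: big1 => ? _).
by case: z => ->; rewrite mxE ?mulr0 ?mul0r ?mulr0 ?mul0r.
Qed.

Lemma tact_select1 (R : comNzRingType) (n r : nat) (A : 'M[R]_(r, n))
    (s2 s3 : 'I_r -> 'I_n) (T : cube R n n n) a b c :
  tact A (select_mx R s2)^T (select_mx R s3)^T T a b c =
  \sum_i A a i * T i (s2 b) (s3 c).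
Proof.
apply: eq_bigr => i _; rewrite -(sum_delta (s2 b) (fun j => T i j (s3 c))).
rewrite big_distrr /=; apply: eq_bigr => j _; rewrite -(sum_delta (s3 c)).
by rewrite !big_distrr /=; apply: eq_bigr => k _; rewrite !mxE !mulrA.
Qed.

Lemma tact_select2 (R : comNzRingType) (n r : nat) (B : 'M[R]_(r, n))
    (s1 s3 : 'I_r -> 'I_n) (T : cube R n n n) a b c :
  tact (select_mx R s1)^T B (select_mx R s3)^T T a b c =
  \sum_j B b j * T (s1 a) j (s3 c).
Proof.
rewrite -(sum_delta (s1 a) (fun i => \sum_j B b j * T i j (s3 c))).
apply: eq_bigr => i _; rewrite big_distrr /=; apply: eq_bigr => j _.
rewrite -(sum_delta (s3 c)) !big_distrr /=; apply: eq_bigr => k _.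
by rewrite !mxE; ring.
Qed.

Lemma tact_select3 (R : comNzRingType) (n r : nat) (C : 'M[R]_(r, n))
    (s1 s2 : 'I_r -> 'I_n) (T : cube R n n n) a b c :
  tact (select_mx R s1)^T (select_mx R s2)^T C T a b c =
  \sum_k C c k * T (s1 a) (s2 b) k.
Proof.
rewrite -(sum_delta (s1 a) (fun i => \sum_k C c k * T i (s2 b) k)).
apply: eq_bigr => i _; rewrite -(sum_delta (s2 b) (fun j => \sum_k C c k * T i j k)).
rewrite big_distrr /=; apply: eq_bigr => j _.
by rewrite !big_distrr /=; apply: eq_bigr => k _; rewrite !mxE; ring.
Qed.

Definition jet_mx (K : fieldType) (m n : nat) (A B : 'M[K]_(m, n)) :
  'M[{poly K}]_(m, n) := map_mx polyC A + 'X *: map_mx polyC B.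

Lemma jet_mx0 (K : fieldType) (m n : nat) (A B : 'M[K]_(m, n)) :
  map_mx (coefp 0) (jet_mx A B) = A.
Proof.
by apply/matrixP => i j; rewrite !mxE /= /coefp coefD coefC coefXM addr0.
Qed.

Lemma jet_mx1 (K : fieldType) (m n : nat) (A B : 'M[K]_(m, n)) :
  map_mx (coefp 1) (jet_mx A B) = B.
Proof.
by apply/matrixP => i j; rewrite !mxE /= /coefp coefD !coefC coefXM coefC add0r.
Qed.

Lemma select_mx_rmorph (R S : comNzRingType) (f : {rmorphism R -> S})
    (n r : nat) (s : 'I_r -> 'I_n) : map_mx f (select_mx R s) = select_mx S s.
Proof. by apply/matrixP => i a; rewrite !mxE rmorph_nat. Qed.

Lemma select_mx_coef1 (K : fieldType) (n r : nat) (s : 'I_r -> 'I_n) :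
  map_mx (coefp 1) (select_mx {poly K} s) = 0.
Proof.
by apply/matrixP => i a; rewrite !mxE /= /coefp; case: (_ == _); rewrite !coefE.
Qed.

(** The base point of the submersion: besides the unit tensor, it carries the
    families of matrices as slices outside the block. *)
Definition base_tensor (K : fieldType) (r d : nat) (M1 M2 M3 : cube K d r r) :
    cube K (r + d) (r + d) (r + d) :=
  fun i j k => match split i, split j, split k with
    | inr s, inl b, inl c => - M1 s b c
    | inl a, inr s, inl c => - M2 s a c
    | inl a, inl b, inr s => - M3 s a b
    | _, _, _ => 0
    end.

Lemma split_lshift (m n : nat) (i : 'I_m) : split (lshift n i) = inl i.
Proof. exact: (unsplitK (inl i)). Qed.

Lemma split_rshift (m n : nat) (i : 'I_n) : split (rshift m i) = inr i.
Proof. exact: (unsplitK (inr i)). Qed.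

(** The linear system of a separating family is the transpose of the
    differential of the parametrization at its base tensor. *)
Lemma separating_differential (K : fieldType) (r d : nat) (M1 M2 M3 : cube K d r r)
    (W : cube K r r r) :
    separating M1 M2 M3 ->
  exists (h1 h2 h3 : 'M[K]_r) (H1 H2 H3 : 'M[K]_(r, d)), forall a b c,
    W a b c = h1 a b * (b == c)%:R + h2 b a * (a == c)%:R + h3 c a * (a == b)%:R
      + (\sum_s H1 a s * M1 s b c + \sum_s H2 b s * M2 s a c
         + \sum_s H3 c s * M3 s a b).
Proof.
move=> /sep_systemP nd.
have [v vW] := injective_system_solve (fun x => W x.1.1 x.1.2 x.2) nd.
exists (\matrix_(a, b) v (inl (inl (inl (a, b))))).
exists (\matrix_(a, b) v (inl (inl (inr (b, a))))).
exists (\matrix_(a, b) v (inl (inr (b, a)))).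
exists (\matrix_(a, s) v (inr (inl (inl (s, a))))).
exists (\matrix_(a, s) v (inr (inl (inr (s, a))))).
exists (\matrix_(a, s) v (inr (inr (s, a)))) => a b c.
rewrite -[LHS](vW (a, b, c)) !big_sumType /= !mxE.
have one (F : 'I_r * 'I_r -> K) (h : 'I_r * 'I_r -> 'I_r * 'I_r * 'I_r) a' b' (e : bool) :
    (forall p, (h p == (a, b, c)) = (p == (a', b')) && e) ->
    \sum_p F p * (h p == (a, b, c))%:R = F (a', b') * e%:R.
  move=> hE; rewrite (bigD1 (a', b')) //= hE eqxx big1 ?addr0 // => p /negPf ne.
  by rewrite hE ne mulr0.
congr (_ + _ + _ + (_ + _ + _)).
- rewrite -(one (fun p => v (inl (inl (inl p)))) (fun p => (p.1, p.2, p.2))).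
    by apply: eq_bigr => -[].
  by case=> x y; rewrite !xpair_eqE /=; case: (y =P b) => [->|]; rewrite ?andbF ?andbT.
- rewrite -(one (fun p => v (inl (inl (inr p)))) (fun p => (p.1, p.2, p.1))).
    by apply: eq_bigr => -[].
  by case=> x y; rewrite !xpair_eqE /=; case: (x =P a) => [->|].
- rewrite -(one (fun p => v (inl (inr p))) (fun p => (p.1, p.1, p.2))).
    by apply: eq_bigr => -[].
  case=> x y; rewrite !xpair_eqE /=; case: (x =P a) => [->|]; rewrite //=.
  by rewrite andbC.
- transitivity (\sum_s \sum_i v (inr (inl (inl (s, i)))) * ((i == a)%:R * M1 s b c)).
    by rewrite pair_bigA; apply: eq_bigr => -[s i].
  apply: eq_bigr => s _; rewrite mxE -(sum_delta a (fun i => v (inr (inl (inl (s, i)))))).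
  by rewrite big_distrl; apply: eq_bigr => i _ /=; rewrite eq_sym; ring.
- transitivity (\sum_s \sum_i v (inr (inl (inr (s, i)))) * ((i == b)%:R * M2 s a c)).
    by rewrite pair_bigA; apply: eq_bigr => -[s i].
  apply: eq_bigr => s _; rewrite mxE -(sum_delta b (fun i => v (inr (inl (inr (s, i)))))).
  by rewrite big_distrl; apply: eq_bigr => i _ /=; rewrite eq_sym; ring.
- transitivity (\sum_s \sum_i v (inr (inr (s, i))) * ((i == c)%:R * M3 s a b)).
    by rewrite pair_bigA; apply: eq_bigr => -[s i].
  apply: eq_bigr => s _; rewrite mxE -(sum_delta c (fun i => v (inr (inr (s, i))))).
  by rewrite big_distrl; apply: eq_bigr => i _ /=; rewrite eq_sym; ring.
Qed.

Lemma assemble_restricts (K : fieldType) (n r : nat) (E1 E2 E3 : 'M[K]_(n, r))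
    (A1 A2 A3 : 'M[K]_(r, n)) (g1 g2 g3 : 'M[K]_r) (S : cube K n n n)
    (T : tensor K n n n) :
    A1 *m E1 = 1%:M -> A2 *m E2 = 1%:M -> A3 *m E3 = 1%:M ->
    g1 \in unitmx -> g2 \in unitmx -> g3 \in unitmx ->
    (forall i j k, T (i, j, k) =
      assemble E1 E2 E3 A1 A2 A3 (tact g1 g2 g3 (@diag_cube K r)) S i j k) ->
  restricts (unit_tensor K r) T.
Proof.
move=> AE1 AE2 AE3 u1 u2 u3 TE; apply/restricts_unitP.
exists (invmx g1 *m A1), (invmx g2 *m A2), (invmx g3 *m A3) => a b c.
rewrite -tact_comp (tact_ext _ _ _ (T := tact g1 g2 g3 (@diag_cube K r))).
  by rewrite tact_comp !mulVmx // tact_id.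
move=> i j k; rewrite -[RHS](tact_assemble _ S i j k AE1 AE2 AE3).
exact: tact_ext.
Qed.

(** The velocity [Y] splits into its part outside the block, which is reached by
    moving [S], and its block, which is reached by moving the factor matrices
    (entries with two equal indices) and the rows [A_t] (the remaining entries,
    by the separating property). *)
Lemma separating_curve (K : fieldType) (r d : nat) (M1 M2 M3 : cube K d r r)
    (Y : cube K (r + d) (r + d) (r + d)) :
    let E := select_mx K (@lshift r d) in
    separating M1 M2 M3 ->
  exists (c : cube {poly K} (r + d) (r + d) (r + d)) (g : {poly K}),
    [/\ g != 0,
      forall i j k, (c i j k)`_0 =
        base_tensor M1 M2 M3 i j k + tact E E E (@diag_cube K r) i j k,
      forall i j k, (c i j k)`_1 = Y i j k
    & forall (t : K) (T : tensor K (r + d) (r + d) (r + d)),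
        (forall i j k, T (i, j, k) = (c i j k).[t]) -> g.[t] != 0 ->
        restricts (unit_tensor K r) T].
Proof.
move=> E sep; pose sh := @lshift r d; pose Et := (select_mx K sh)^T.
have sh_inj : injective sh by apply: lshift_inj.
have EtE : Et *m E = 1%:M by apply: select_tr_mul.
pose W := tact Et Et Et Y; pose S0 := base_tensor M1 M2 M3.
pose S1 : cube K (r + d) (r + d) (r + d) := fun i j k => Y i j k - tact E E E W i j k.
have EtS0 a b c : tact Et Et Et S0 a b c = 0.
  by rewrite tact_select_tr /S0 /base_tensor /sh !split_lshift.
have EtS1 a b c : tact Et Et Et S1 a b c = 0.
  by rewrite tactD tactN tact_comp !EtE tact_id subrr.
have [h1 [h2 [h3 [H1 [H2 [H3 hW]]]]]] := separating_differential W sep.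
pose pad (H : 'M[K]_(r, d)) : 'M[K]_(r, r + d) := row_mx 0 H.
pose A H := jet_mx Et (pad H); pose g h := jet_mx (1%:M : 'M[K]_r) h.
pose EX := select_mx {poly K} sh.
pose S : cube {poly K} _ _ _ := fun i j k => (S0 i j k)%:P + 'X * (S1 i j k)%:P.
have S_0 i j k : (S i j k)`_0 = S0 i j k by rewrite coefD coefC coefXM addr0.
have S_1 i j k : (S i j k)`_1 = S1 i j k.
  by rewrite coefD !coefC coefXM coefC add0r.
pose D := tact (g h1) (g h2) (g h3) (@diag_cube {poly K} r).
pose c := assemble EX EX EX (A H1) (A H2) (A H3) D S.
have EX0 : map_mx (coefp 0) EX = E by apply: select_mx_rmorph.
have EX1 : map_mx (coefp 1) EX = 0 by apply: select_mx_coef1.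
have c0 i j k : (c i j k)`_0 = S0 i j k + tact E E E (@diag_cube K r) i j k.
  rewrite coefD S_0 tact_coef0 EX0; congr (_ + _); apply: tact_ext => a b e.
  rewrite coefB !tact_coef0 !jet_mx0 (tact_ext _ _ _ (T := S0)) // EtS0 subr0.
  rewrite (tact_ext _ _ _ (T := @diag_cube K r)) ?tact_id // => a' b' e'.
  by rewrite /diag_cube; case: (_ && _); rewrite !coefE.
have diag_1 a b e : tact 1%:M 1%:M 1%:M
    (fun i j k => (@diag_cube {poly K} r i j k)`_1) a b e = 0.
  by rewrite tact_id /diag_cube; case: (_ && _); rewrite !coefE.
have diag_0 a b e : (@diag_cube {poly K} r a b e)`_0 = diag_cube K a b e.
  by rewrite /diag_cube; case: (_ && _); rewrite !coefE.
have D1 a b e : (D a b e)`_1 =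
    h1 a b * (b == e)%:R + h2 b a * (a == e)%:R + h3 e a * (a == b)%:R.
  rewrite tact_coef1 !jet_mx0 !jet_mx1 diag_1 addr0.
  rewrite !(tact_ext _ _ _ (T := @diag_cube K r)) // !tact_diag.
  congr (_ + _ + _).
  - rewrite -(sum_delta b (fun j => h1 a j * (j == e)%:R)).
    by apply: eq_bigr => j _; rewrite !mxE (eq_sym e); ring.
  - rewrite -(sum_delta a (fun j => h2 b j * (j == e)%:R)).
    by apply: eq_bigr => j _; rewrite !mxE (eq_sym e); ring.
  - rewrite -(sum_delta a (fun j => h3 e j * (j == b)%:R)).
    by apply: eq_bigr => j _; rewrite !mxE (eq_sym b); ring.
have A1 a b e : (tact (A H1) (A H2) (A H3) S a b e)`_1 =
    - (\sum_s H1 a s * M1 s b e + \sum_s H2 b s * M2 s a e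
         + \sum_s H3 e s * M3 s a b).
  rewrite tact_coef1 !jet_mx0 !jet_mx1.
  rewrite [X in _ + X = _](tact_ext _ _ _ (T := S1)) // EtS1 addr0.
  rewrite tact_select1 tact_select2 tact_select3 !big_split_ord /=.
  have z H a' (F : 'I_r -> K) : \sum_i pad H a' (lshift d i) * F i = 0.
    by apply: big1 => i _; rewrite row_mxEl mxE mul0r.
  rewrite !z !add0r !opprD -!sumrN; congr (_ + _ + _); apply: eq_bigr => s _;
    by rewrite row_mxEr S_0 /S0 /base_tensor /sh !split_lshift split_rshift mulrN.
have c1 i j k : (c i j k)`_1 = Y i j k.
  rewrite coefD S_1 tact_coef1 EX0 EX1.
  do 3!(rewrite tact_mx0 ?add0r; last by [constructor 1|constructor 2|constructor 3]).
  rewrite (tact_ext _ _ _ (T := W)) ?subrK // => a b e.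
  by rewrite coefB D1 A1 opprK hW.
pose G := \det (g h1) * \det (g h2) * \det (g h3).
have jet_eval m n (P Q : 'M[K]_(m, n)) t :
    map_mx (horner_eval t) (jet_mx P Q) = P + t *: Q.
  apply/matrixP => i j; rewrite !mxE /= /horner_eval hornerD hornerM hornerX.
  by rewrite !hornerC.
have det_g h t : (\det (g h)).[t] = \det (1%:M + t *: h).
  by rewrite -jet_eval det_map_mx.
exists c, G; split=> // [|t T TE].
  apply/eqP => /(congr1 (horner^~ 0)); rewrite !hornerM !det_g !scale0r !addr0.
  by rewrite !det1 !mulr1 horner0 => /eqP; rewrite oner_eq0.
rewrite !hornerM !det_g !mulf_eq0 !negb_or -andbA => /and3P [u1 u2 u3].
have AE H : (Et + t *: pad H) *m E = 1%:M.
  rewrite mulmxDl EtE -scalemxAl; suff -> : pad H *m E = 0.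
    by rewrite scaler0 addr0.
  by apply/matrixP => a b; rewrite mulmx_select row_mxEl !mxE.
apply: (@assemble_restricts _ _ _ E E E (Et + t *: pad H1) (Et + t *: pad H2)
  (Et + t *: pad H3) (1%:M + t *: h1) (1%:M + t *: h2) (1%:M + t *: h3)
  (fun i j k => (S i j k).[t])) => //; rewrite ?unitmxE ?unitfE // => i j k.
rewrite TE -[LHS]/(horner_eval t (c i j k)) assemble_rmorph !jet_eval.
rewrite /EX select_mx_rmorph; congr (_ + _); apply: tact_ext => a b e.
congr (_ - _); rewrite tact_rmorph !jet_eval; apply: tact_ext => a' b' e'.
by rewrite /diag_cube rmorph_nat.
Qed.

Lemma separable_dense (K : fieldType) (r d : nat) :
    infinite_type K -> separable K r d d d ->
  zariski_dense (fun T : tensor K (r + d) (r + d) (r + d) => subrank_ge r T).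
Proof.
move=> hK [M1 [M2 [M3 sep]]] Z [F ZF] CZ T0; apply/ZF => p Fp.
apply/eqP; apply: contraT => pT0.
have p0 : p != 0 by apply: contraNneq pT0 => ->; rewrite /tensor_eval meval0.
pose E := select_mx K (@lshift r d).
pose b := fun y : 'I_(r + d) * 'I_(r + d) * 'I_(r + d) =>
  base_tensor M1 M2 M3 y.1.1 y.1.2 y.2
  + tact E E E (@diag_cube K r) y.1.1 y.1.2 y.2.
have [y hy] := nonvanishing_along_jets (fun m => b (enum_val m)) hK p0.
have [c [g [g0 c0 c1 cT]]] :=
  separating_curve (fun i j k => y (enum_rank (i, j, k))) sep.
have [m|m|t pt gt] := hy (fun m => let: (i, j, k) := enum_val m in c i j k) g _ _ g0.
- by case: (enum_val m) => -[i j] k; rewrite c0.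
- by case E' : (enum_val m) => [[i j] k]; rewrite c1 -E' enum_valK.
pose T : tensor K (r + d) (r + d) (r + d) := [ffun z => (c z.1.1 z.1.2 z.2).[t]].
have rT : restricts (unit_tensor K r) T.
  by apply: cT gt => i j k; rewrite ffunE.
have /ZF/(_ p Fp) pT := CZ _ (restricts_subrank_ge rT).
case/negP: pt; rewrite -[X in _ == X]pT; apply/eqP/meval_eq => m.
by rewrite ffunE; case: (enum_val m) => -[].
Qed.

(** * Adding an index to a separating family *)

(** [X1], [X2], [X3] stand for the slices of a tensor through a new index, in each
    of the three modes; the other indices are below [m]. A new matrix with two
    nonzero entries, one in the new row and one in the new column, links a line of
    one slice to a line of another (the lists [L1], [L2], [L3]); a matrix with a
    single old entry kills a cell of one slice (the lists [Z1], [Z2], [Z3]). *)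
Definition slices_determined (K : fieldType) (m : nat)
    (L1 L2 L3 Z1 Z2 Z3 : seq (nat * nat)) : Prop :=
  forall X1 X2 X3 : nat -> nat -> K,
    (forall a, (a < m)%N -> [/\ X1 a a = 0, X2 a a = 0 & X3 a a = 0]) ->
    (forall c, c \in L1 -> forall i, (i < m)%N -> X2 i c.1 + X3 i c.2 = 0) ->
    (forall c, c \in L2 -> forall j, (j < m)%N -> X1 j c.1 + X3 c.2 j = 0) ->
    (forall c, c \in L3 -> forall k, (k < m)%N -> X1 c.1 k + X2 c.2 k = 0) ->
    (forall z, z \in Z1 -> X1 z.1 z.2 = 0) ->
    (forall z, z \in Z2 -> X2 z.1 z.2 = 0) ->
    (forall z, z \in Z3 -> X3 z.1 z.2 = 0) ->
  forall a b, (a < m)%N -> (b < m)%N -> [/\ X1 a b = 0, X2 a b = 0 & X3 a b = 0].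

Definition entry (m : nat) (Z : seq (nat * nat)) (s : nat) : 'I_m.+1 * 'I_m.+1 :=
  (inord (nth (0, 0)%N Z s).1, inord (nth (0, 0)%N Z s).2).

Notation old := (lift ord0).

(** The new index is [ord0]. The first [d] members extend those of [M] by zero, the
    last [e] have their new row and column prescribed by [L]; every member is
    moved by [t] in the direction of the single entry prescribed by [Z]. *)
Definition extend_family (K : fieldType) (m d e : nat) (M : cube K d m.+1 m.+1)
    (L Z : seq (nat * nat)) (t : K) : cube K (d + e) m.+2 m.+2 :=
  fun s x y => match unlift ord0 x, unlift ord0 y with
    | Some j, Some k =>
        (if split s is inl s0 then M s0 j k else 0) + t * (entry m Z s == (j, k))%:R
    | None, Some k =>
        if split s is inr s1 then ((entry m L s1).1 == k)%:R else 0
    | Some j, None =>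
        if split s is inr s1 then ((entry m L s1).2 == j)%:R else 0
    | None, None => 0
    end.

Lemma sum_square_recl (R : nmodType) (m : nat) (G : 'I_m.+1 -> 'I_m.+1 -> R) :
  \sum_x \sum_y G x y = G ord0 ord0 + \sum_k G ord0 (old k)
    + (\sum_j G (old j) ord0 + \sum_j \sum_k G (old j) (old k)).
Proof.
rewrite big_ord_recl [X in X + _]big_ord_recl -big_split; congr (_ + _).
by apply: eq_bigr => j _; rewrite big_ord_recl.
Qed.

Lemma extend_family_sum (K : fieldType) (m d e : nat) (M : cube K d m.+1 m.+1)
    (L Z : seq (nat * nat)) (t : K) (s : 'I_(d + e)) (F : 'I_m.+2 -> 'I_m.+2 -> K) :
  \sum_x \sum_y extend_family M L Z t s x y * F x y =
  (if split s is inl s0 then \sum_j \sum_k M s0 j k * F (old j) (old k) else 0)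
  + (if split s is inr s1 then
       F ord0 (old (entry m L s1).1) + F (old (entry m L s1).2) ord0 else 0)
  + t * F (old (entry m Z s).1) (old (entry m Z s).2).
Proof.
have dZ : \sum_j \sum_k (entry m Z s == (j, k))%:R * F (old j) (old k) =
    F (old (entry m Z s).1) (old (entry m Z s).2).
  rewrite pair_bigA -[RHS](sum_delta (entry m Z s) (fun z => F (old z.1) (old z.2))).
  by apply: eq_bigr => -[j k].
rewrite -dZ sum_square_recl /extend_family /= unlift_none mul0r add0r.
under eq_bigr => k _ do rewrite liftK.
under [X in _ + (X + _) = _]eq_bigr => j _ do rewrite liftK.
rewrite addrA addrC [RHS]addrAC; congr (_ + _); last first.
  case: (split s) => s1; last by rewrite !sum_delta.
  by rewrite !big1 ?addr0 // => i _; rewrite mul0r.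
transitivity (\sum_j \sum_k
   ((if split s is inl s0 then M s0 j k else 0) * F (old j) (old k)
    + t * ((entry m Z s == (j, k))%:R * F (old j) (old k)))).
  by do 2!(apply: eq_bigr => ? _); rewrite !liftK mulrDl mulrA.
rewrite big_distrr /=.
under eq_bigr => j _ do rewrite big_split -big_distrr /=.
rewrite big_split; congr (_ + _); case: (split s) => // s1.
by do 2!(apply: big1 => ? _); rewrite mul0r.
Qed.

(** The equations given by an old matrix and an old slice only see the old tensor,
    and force it to vanish because they form a pencil that is injective at
    [t = 0]. The others then only see the three new slices; up to the factor [t]
    they form a pencil that is injective at infinity, where the old matrices
    disappear and only single entries remain. A generic [t] serves for both. *)
Lemma separating_extend (K : fieldType) (m d1 d2 d3 e1 e2 e3 : nat)
    (L1 L2 L3 Z1 Z2 Z3 : seq (nat * nat)) :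
    infinite_type K -> slices_determined K m.+1 L1 L2 L3 Z1 Z2 Z3 ->
    (size L1 <= e1)%N -> (size L2 <= e2)%N -> (size L3 <= e3)%N ->
    (size Z1 <= d1 + e1)%N -> (size Z2 <= d2 + e2)%N -> (size Z3 <= d3 + e3)%N ->
  separable K m.+1 d1 d2 d3 -> separable K m.+2 (d1 + e1) (d2 + e2) (d3 + e3).
Proof.
move=> hK det sL1 sL2 sL3 sZ1 sZ2 sZ3 [M1 [M2 [M3 sep]]].
pose z1 s := entry m Z1 s; pose z2 s := entry m Z2 s; pose z3 s := entry m Z3 s.
pose c1 s := entry m L1 s; pose c2 s := entry m L2 s; pose c3 s := entry m L3 s.
(* The equations on old tensors: the given family, perturbed by single entries. *)
pose a1 (p : sep_index m.+1 d1 d2 d3) (x : 'I_m.+1 * 'I_m.+1 * 'I_m.+1) : K :=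
  match p with
  | inl _ => 0
  | inr (inl (inl (s, i))) => ((i, (z1 s).1, (z1 s).2) == x)%:R
  | inr (inl (inr (s, j))) => (((z2 s).1, j, (z2 s).2) == x)%:R
  | inr (inr (s, k)) => (((z3 s).1, (z3 s).2, k) == x)%:R
  end.
have [|f f0 fP] := @injective_pencil _ _ _ (sep_system M1 M2 M3) a1.
  by left; apply/sep_systemP.
(* The equations on the slices: the single entries, perturbed by the family. *)
pose cell : finType := ('I_m.+1 * 'I_m.+1)%type.
pose unknown : finType := (cell + cell + cell)%type.
pose u1 (z : cell) : unknown := inl (inl z).
pose u2 (z : cell) : unknown := inl (inr z).
pose u3 (z : cell) : unknown := inr z.
pose eqn : finType := ('I_m.+1 + 'I_m.+1 + 'I_m.+1
  + ('I_e1 * 'I_m.+1 + 'I_e2 * 'I_m.+1 + 'I_e3 * 'I_m.+1)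
  + ('I_(d1 + e1) + 'I_(d2 + e2) + 'I_(d3 + e3)))%type.
pose l1 (p : eqn) (u : unknown) : K :=
  match p with
  | inl (inl (inl (inl a))) => (u1 (a, a) == u)%:R
  | inl (inl (inl (inr a))) => (u2 (a, a) == u)%:R
  | inl (inl (inr a)) => (u3 (a, a) == u)%:R
  | inl (inr (inl (inl (s, i)))) =>
      (u2 (i, (c1 s).1) == u)%:R + (u3 (i, (c1 s).2) == u)%:R
  | inl (inr (inl (inr (s, j)))) =>
      (u1 (j, (c2 s).1) == u)%:R + (u3 ((c2 s).2, j) == u)%:R
  | inl (inr (inr (s, k))) =>
      (u1 ((c3 s).1, k) == u)%:R + (u2 ((c3 s).2, k) == u)%:R
  | inr (inl (inl s)) => (u1 (z1 s) == u)%:R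
  | inr (inl (inr s)) => (u2 (z2 s) == u)%:R
  | inr (inr s) => (u3 (z3 s) == u)%:R
  end.
pose l0 (p : eqn) (u : unknown) : K :=
  match p, u with
  | inr (inl (inl s)), inl (inl (j, k)) => if split s is inl s0 then M1 s0 j k else 0
  | inr (inl (inr s)), inl (inr (i, k)) => if split s is inl s0 then M2 s0 i k else 0
  | inr (inr s), inr (i, j) => if split s is inl s0 then M3 s0 i j else 0
  | _, _ => 0
  end.
have nd1 : injective_system l1.
  move=> T lT.
  pose X (u : cell -> unknown) (a b : nat) := T (u (inord a, inord b)).
  have TX (u : cell -> unknown) (z : cell) : T (u z) = X u z.1 z.2.
    by rewrite /X !inord_val; case: z.
  have entryP (S : seq (nat * nat)) e c : (size S <= e)%N -> c \in S ->
      exists s : 'I_e, nth (0, 0)%N S s = c.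
    move=> Se cS; have lt_e : (index c S < e)%N by rewrite (leq_trans _ Se) ?index_mem.
    by exists (Ordinal lt_e); rewrite nth_index.
  suff all0 a b : (a < m.+1)%N -> (b < m.+1)%N ->
      [/\ X u1 a b = 0, X u2 a b = 0 & X u3 a b = 0].
    case=> [[z|z]|z]; [rewrite (TX u1)|rewrite (TX u2)|rewrite (TX u3)];
      by case: (all0 z.1 z.2).
  have two (v w : unknown) : \sum_u ((v == u)%:R + (w == u)%:R) * T u = T v + T w.
    by under eq_bigr do rewrite mulrDl; rewrite big_split /= !sum_delta.
  apply: det => [a' lt_a|c cL i lt_i|c cL i lt_i|c cL i lt_i|z zZ|z zZ|z zZ].
  - rewrite /X; split.
    + by rewrite -[RHS](lT (inl (inl (inl (inl (inord a')))))) /= sum_delta.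
    + by rewrite -[RHS](lT (inl (inl (inl (inr (inord a')))))) /= sum_delta.
    + by rewrite -[RHS](lT (inl (inl (inr (inord a'))))) /= sum_delta.
  - have [s cE] := entryP _ _ _ sL1 cL.
    by rewrite -[RHS](lT (inl (inr (inl (inl (s, inord i)))))) /= two cE.
  - have [s cE] := entryP _ _ _ sL2 cL.
    by rewrite -[RHS](lT (inl (inr (inl (inr (s, inord i)))))) /= two cE.
  - have [s cE] := entryP _ _ _ sL3 cL.
    by rewrite -[RHS](lT (inl (inr (inr (s, inord i))))) /= two cE.
  - have [s cE] := entryP _ _ _ sZ1 zZ.
    by rewrite -[RHS](lT (inr (inl (inl s)))) /= sum_delta /z1 /entry cE.
  - have [s cE] := entryP _ _ _ sZ2 zZ.
    by rewrite -[RHS](lT (inr (inl (inr s)))) /= sum_delta /z2 /entry cE.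
  - have [s cE] := entryP _ _ _ sZ3 zZ.
    by rewrite -[RHS](lT (inr (inr s))) /= sum_delta /z3 /entry cE.
have [g g0 gP] := @injective_pencil _ _ _ l0 l1 (or_intror nd1).
have [t] := poly_nonroot hK (mulf_neq0 f0 g0).
rewrite hornerM mulf_eq0 negb_or => /andP [/fP ndf /gP ndg].
exists (extend_family M1 L1 Z1 t), (extend_family M2 L2 Z2 t),
  (extend_family M3 L3 Z3 t) => T off T1 T2 T3.
pose To i j k := T (old i) (old j) (old k).
have To0 i j k : To i j k = 0.
  apply: (ndf (fun x => To x.1.1 x.1.2 x.2) _ (i, j, k)) => p.
  rewrite /pencil; under eq_bigr do rewrite mulrDl -mulrA.
  rewrite big_split -big_distrr /=.
  case: p => [[[[a b]|[a b]]|[a b]]|[[[s a]|[s a]]|[s a]]] /=.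
  - rewrite sum_delta big1 ?mulr0 ?addr0 => [|x _]; rewrite ?mul0r //.
    by case: (off (old a) (old b)).
  - rewrite sum_delta big1 ?mulr0 ?addr0 => [|x _]; rewrite ?mul0r //.
    by case: (off (old a) (old b)).
  - rewrite sum_delta big1 ?mulr0 ?addr0 => [|x _]; rewrite ?mul0r //.
    by case: (off (old a) (old b)).
  - rewrite -[RHS](T1 (lshift e1 s) (old a)) extend_family_sum split_lshift addr0.
    by rewrite (sep_sum1 a (M1 s) (fun x => To x.1.1 x.1.2 x.2)) sum_delta.
  - rewrite -[RHS](T2 (lshift e2 s) (old a)).
    rewrite (extend_family_sum _ _ _ _ _ (fun x y => T x (old a) y)) split_lshift addr0.
    by rewrite (sep_sum2 a (M2 s) (fun x => To x.1.1 x.1.2 x.2)) sum_delta.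
  - rewrite -[RHS](T3 (lshift e3 s) (old a)).
    rewrite (extend_family_sum _ _ _ _ _ (fun x y => T x y (old a))) split_lshift addr0.
    by rewrite (sep_sum3 a (M3 s) (fun x => To x.1.1 x.1.2 x.2)) sum_delta.
pose V (u : unknown) : K := match u with
  | inl (inl z) => T ord0 (old z.1) (old z.2)
  | inl (inr z) => T (old z.1) ord0 (old z.2)
  | inr z => T (old z.1) (old z.2) ord0
  end.
have o1 a b : T a b b = 0 by case: (off a b).
have o2 a b : T a b a = 0 by case: (off a b).
have o3 a b : T a a b = 0 by case: (off a b).
have V0 u : V u = 0.
  apply: ndg => p; rewrite /pencil; under eq_bigr do rewrite mulrDl -mulrA.
  rewrite big_split -big_distrr /=.
  have none (l : unknown -> K) : (forall v, l v = 0) -> \sum_v l v * V v = 0.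
    by move=> l0u; apply: big1 => v _; rewrite l0u mul0r.
  have two (v w : unknown) : \sum_x ((v == x)%:R + (w == x)%:R) * V x = V v + V w.
    by under eq_bigr do rewrite mulrDl; rewrite big_split /= !sum_delta.
  case: p => [[[[a|a]|a]|[[[s i]|[s j]]|[s k]]]|[[s|s]|s]] /=.
  - by rewrite none ?sum_delta ?add0r //= o1 mulr0.
  - by rewrite none ?sum_delta ?add0r //= o2 mulr0.
  - by rewrite none ?sum_delta ?add0r //= o3 mulr0.
  - rewrite none // two add0r; have := T1 (rshift d1 s) (old i).
    rewrite extend_family_sum split_rshift add0r [T (old _) (old _) (old _)]To0.
    rewrite mulr0 addr0 /= => ->.
    exact: mulr0.
  - rewrite none // two add0r; have := T2 (rshift d2 s) (old j).
    rewrite (extend_family_sum _ _ _ _ _ (fun x y => T x (old j) y)) split_rshift.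
    by rewrite add0r [T (old _) (old _) (old _)]To0 mulr0 addr0 /= => ->; rewrite mulr0.
  - rewrite none // two add0r; have := T3 (rshift d3 s) (old k).
    rewrite (extend_family_sum _ _ _ _ _ (fun x y => T x y (old k))) split_rshift.
    by rewrite add0r [T (old _) (old _) (old _)]To0 mulr0 addr0 /= => ->; rewrite mulr0.
  - rewrite sum_delta -[RHS](T1 s ord0) extend_family_sum.
    rewrite [X in _ = _ + X + _](_ : _ = 0); last first.
      by case: (split s) => // s'; rewrite o3 o2 addr0.
    rewrite addr0; congr (_ + _); rewrite !big_sumType /=.
    rewrite [X in _ + X + _]big1 ?[X in _ + X]big1 ?addr0 => [|z _|z _];
      rewrite ?mul0r //.
    case: (split s) => s'; last by apply: big1 => -[j k] _; rewrite mul0r.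
    by rewrite pair_bigA; apply: eq_bigr => -[].
  - rewrite sum_delta -[RHS](T2 s ord0).
    rewrite (extend_family_sum _ _ _ _ _ (fun x y => T x ord0 y)).
    rewrite [X in _ = _ + X + _](_ : _ = 0); last first.
      by case: (split s) => // s'; rewrite o1 o3 addr0.
    rewrite addr0; congr (_ + _); rewrite !big_sumType /=.
    rewrite [X in X + _ + _]big1 ?[X in _ + X]big1 ?add0r ?addr0 => [|z _|z _];
      rewrite ?mul0r //.
    case: (split s) => s'; last by apply: big1 => -[j k] _; rewrite mul0r.
    by rewrite pair_bigA; apply: eq_bigr => -[].
  - rewrite sum_delta -[RHS](T3 s ord0).
    rewrite (extend_family_sum _ _ _ _ _ (fun x y => T x y ord0)).
    rewrite [X in _ = _ + X + _](_ : _ = 0); last first.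
      by case: (split s) => // s'; rewrite o1 o2 addr0.
    rewrite addr0; congr (_ + _); rewrite !big_sumType /=.
    rewrite [X in X + _ + _]big1 ?[X in _ + X + _]big1 ?add0r => [|z _|z _];
      rewrite ?mul0r //.
    case: (split s) => s'; last by apply: big1 => -[j k] _; rewrite mul0r.
    by rewrite pair_bigA; apply: eq_bigr => -[].
move=> i j k; case: (unliftP ord0 i) => [i'|] ->; case: (unliftP ord0 j) => [j'|] ->;
  case: (unliftP ord0 k) => [k'|] ->; rewrite ?o1 ?o2 ?o3 //.
- exact: To0.
- exact: (V0 (u3 (i', j'))).
- exact: (V0 (u2 (i', k'))).
- exact: (V0 (u1 (j', k'))).
Qed.

(** * Separating families of every size *)

Lemma separable_swap12 (K : fieldType) (r d1 d2 d3 : nat) :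
  separable K r d1 d2 d3 -> separable K r d2 d1 d3.
Proof.
case=> [M1 [M2 [M3 sep]]]; exists M2, M1, (fun s i j => M3 s j i).
move=> T off T1 T2 T3 i j k.
apply: (sep (fun i j k => T j i k)) => [a b|s i'|s j'|s k'].
- by case: (off a b) => e1 e2 e3; case: (off b a) => f1 f2 f3.
- exact: T2.
- exact: T1.
- by rewrite exchange_big; apply: T3.
Qed.

Lemma separable_swap23 (K : fieldType) (r d1 d2 d3 : nat) :
  separable K r d1 d2 d3 -> separable K r d1 d3 d2.
Proof.
case=> [M1 [M2 [M3 sep]]]; exists (fun s j k => M1 s k j), M3, M2.
move=> T off T1 T2 T3 i j k.
apply: (sep (fun i j k => T i k j)) => [a b|s i'|s j'|s k'].
- by case: (off a b) => e1 e2 e3; case: (off b a) => f1 f2 f3.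
- by rewrite exchange_big; apply: T1.
- exact: T3.
- exact: T2.
Qed.

Lemma separable_leq (K : fieldType) (r d1 d2 d3 e1 e2 e3 : nat) :
    (d1 <= e1)%N -> (d2 <= e2)%N -> (d3 <= e3)%N ->
  separable K r d1 d2 d3 -> separable K r e1 e2 e3.
Proof.
move=> l1 l2 l3 [M1 [M2 [M3 sep]]].
pose ext d e (M : cube K d r r) : cube K e r r := fun s i j =>
  if insub (s : nat) is Some s' then M s' i j else 0.
have extE d e (M : cube K d r r) (lde : (d <= e)%N) s :
    ext d e M (widen_ord lde s) = M s by rewrite /ext valK.
exists (ext _ e1 M1), (ext _ e2 M2), (ext _ e3 M3) => T off T1 T2 T3.
apply: sep => // s i.
- by rewrite -[RHS](T1 (widen_ord l1 s) i) extE.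
- by rewrite -[RHS](T2 (widen_ord l2 s) i) extE.
- by rewrite -[RHS](T3 (widen_ord l3 s) i) extE.
Qed.

(** The cells at distance at least two from the diagonal of a square of side
    [m.+1]. The cells of the first row come first and those of the first column
    last, so that a short initial segment avoids the latter and a short final
    segment the former. *)
Definition far_row (m : nat) : seq (nat * nat) :=
  [seq (0, k.+2)%N | k <- iota 0 m.-1].
Definition far_inner (m : nat) : seq (nat * nat) :=
  [seq (if a <= b then (a.+1, b.+3) else (a.+2, b.+1))%N
  | a <- iota 0 m.-1, b <- iota 0 m.-2].
Definition far_column (m : nat) : seq (nat * nat) :=
  [seq (j.+2, 0)%N | j <- iota 0 m.-1].
Definition far_cells (m : nat) : seq (nat * nat) :=
  far_row m ++ far_inner m ++ far_column m.

Lemma size_far_cells (m : nat) : size (far_cells m) = (m * m.-1)%N.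
Proof.
rewrite !size_cat !size_map size_allpairs !size_iota.
by case: m => [|[|m]] //=; lia.
Qed.

Lemma mem_far_cells (m a b : nat) :
  (a <= m)%N -> (b <= m)%N -> (a.+1 < b)%N || (b.+1 < a)%N ->
  (a, b) \in far_cells m.
Proof.
move=> am bm far; rewrite !mem_cat.
case: a b far am bm => [|a] [|b] //= far am bm; apply/or3P.
- constructor 1; apply/mapP; exists b.-1; first by rewrite mem_iota; lia.
  by congr (_, _); lia.
- constructor 3; apply/mapP; exists a.-1; first by rewrite mem_iota; lia.
  by congr (_, _); lia.
constructor 2; apply/allpairsP; case: (ltnP a b) => ab.
  exists (a, b.-2); rewrite /= !mem_iota; split; [lia|lia|].
  by rewrite ifT; [congr (_, _); lia|lia].
exists (a.-1, b); rewrite /= !mem_iota; split; [lia|lia|].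
by rewrite ifF; [congr (_, _); lia|apply/negbTE; lia].
Qed.

Lemma take_far_cells (m e : nat) z : (e <= m.-1 * m.-1)%N ->
  z \in take e (far_cells m) -> (0 < z.2)%N.
Proof.
move=> le_e; rewrite /far_cells catA takel_cat.
  move/mem_take; rewrite mem_cat => /orP [/mapP [k _ ->] //|/allpairsP [[a b]]].
  by case=> _ _ ->; case: ifP.
rewrite size_cat size_map size_allpairs !size_iota; apply: leq_trans le_e _.
by case: m => [|[|m]] //=; lia.
Qed.

Lemma drop_far_cells (m e : nat) z : (m.-1 <= e)%N ->
  z \in drop e (far_cells m) -> (0 < z.1)%N.
Proof.
move=> le_e; rewrite /far_cells drop_cat size_map size_iota ltnNge le_e /=.
move/mem_drop; rewrite mem_cat => /orP [/allpairsP [[a b]]|/mapP [j _ ->] //].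
by case=> _ _ ->; case: ifP.
Qed.

Definition shift_lines (m : nat) : seq (nat * nat) := [seq (c.+1, c) | c <- iota 0 m].
Definition last_row (m : nat) : seq (nat * nat) := [seq (m, k) | k <- iota 0 m].

(** Identify column [c.+1] of [X1] with row [c] of [X3], and row [c.+1] of [X1]
    with row [c] of [X2]: each cell of [X1] is then linked to at most one cell of
    [X2] and one of [X3], the last rows of [X2] and [X3] stay free, and the cells
    next to the diagonal are linked to the diagonal. The remaining groups of
    linked cells are indexed by the far cells of [X1]; each is killed by a single
    equation, that can be placed in [X1], in [X2] off the first row and in [X3]
    off the first column. *)
Lemma star_slices_determined (K : fieldType) (m e1 e3 : nat) :
    (e3 <= m.-1 * m.-1)%N -> (m.-1 <= e1 + e3)%N ->
  slices_determined K m.+1 [::] (shift_lines m) (shift_lines m)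
    (take e1 (drop e3 (far_cells m)))
    ([seq (z.1.-1, z.2) | z <- drop (e1 + e3) (far_cells m)] ++ last_row m)
    ([seq (z.2.-1, z.1) | z <- take e3 (far_cells m)] ++ last_row m).
Proof.
move=> le3 le13 X1 X2 X3 diag _ L2 L3 Z1 Z2 Z3.
have l2 c j : (c < m)%N -> (j < m.+1)%N -> X1 j c.+1 + X3 c j = 0.
  by move=> cm jm; apply: (L2 (c.+1, c)) => //; apply/map_f; rewrite mem_iota.
have l3 c k : (c < m)%N -> (k < m.+1)%N -> X1 c.+1 k + X2 c k = 0.
  by move=> cm km; apply: (L3 (c.+1, c)) => //; apply/map_f; rewrite mem_iota.
have x1 a b : (a < m.+1)%N -> (b < m.+1)%N -> X1 a b = 0.
  move=> am bm; have [->|ne_ab] := eqVneq a b; first by case: (diag b).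
  have [Ea|na] := eqVneq a b.+1.
    have := l3 b b; rewrite Ea; case: (diag b) => // _ -> _.
    by rewrite addr0 => -> //; lia.
  have [Eb|nb] := eqVneq b a.+1.
    have := l2 a a; rewrite Eb; case: (diag a) => // _ _ ->.
    by rewrite addr0 => -> //; lia.
  have := @mem_far_cells m a b am bm; rewrite -(cat_take_drop e3 (far_cells m)).
  rewrite -(cat_take_drop e1 (drop e3 _)) drop_drop !mem_cat.
  case/(_ _)/or3P => [|in3|in1|in2]; first lia.
  - have b0 := take_far_cells le3 in3; case: b b0 {na nb ne_ab} bm in3 => // b _ bm in3.
    have := l2 b a bm am; rewrite (Z3 (b, a)) ?addr0 // mem_cat.
    by apply/orP; left; apply/mapP; exists (a, b.+1).
  - exact: (Z1 (a, b)).
  - have a0 := drop_far_cells le13 in2; case: a a0 {na nb ne_ab} am in2 => // a _ am in2.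
    have := l3 a b am bm; rewrite (Z2 (a, b)) ?addr0 // mem_cat.
    by apply/orP; left; apply/mapP; exists (a.+1, b).
move=> a b am bm; split; first exact: x1.
- have [lt_am|] := ltnP a m; first by have := l3 a b lt_am bm; rewrite x1 // add0r.
  have [lt_bm|ge_bm] := ltnP b m => ge_am; last first.
    by have -> : a = b; [lia|case: (diag b)].
  apply: (Z2 (a, b)); have -> : a = m by lia.
  by rewrite mem_cat; apply/orP; right; apply/map_f; rewrite mem_iota.
- have [lt_am|] := ltnP a m; first by have := l2 a b lt_am bm; rewrite x1 // add0r.
  have [lt_bm|ge_bm] := ltnP b m => ge_am; last first.
    by have -> : a = b; [lia|case: (diag b)].
  apply: (Z3 (a, b)); have -> : a = m by lia.
  by rewrite mem_cat; apply/orP; right; apply/map_f; rewrite mem_iota.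
Qed.

Lemma separable_star_step (K : fieldType) (m e1 e2 e3 : nat) :
    infinite_type K -> (e3 <= m.-1 * m.-1)%N -> (m.-1 <= e1 + e3)%N ->
    (m * m.-1 <= e1 + e2 + e3)%N ->
  separable K m.+1 e1 e2 e3 -> separable K m.+2 e1 (e2 + m) (e3 + m).
Proof.
move=> hK le3 le13 le_all sep; rewrite -[e1]addn0.
apply: (separating_extend hK (star_slices_determined le3 le13) _ _ _ _ _ _ sep) => //;
  rewrite ?size_cat ?size_map ?size_take_min ?size_drop ?size_iota ?size_far_cells;
  lia.
Qed.

Ltac instances3 H c :=
  have /= := H c isT 0%N isT; have /= := H c isT 1%N isT;
  have /= := H c isT 2%N isT.
Ltac instances4 H c := instances3 H c; have /= := H c isT 3%N isT.

(* Groups of linked cells are trees: zeros propagate along the links. *)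
Ltac propagate_zeros :=
  repeat match goal with
    | Hx : ?x = 0, H : ?x + ?y = 0 |- _ => rewrite Hx add0r in H
    | Hy : ?y = 0, H : ?x + ?y = 0 |- _ => rewrite Hy addr0 in H
    end.

(** In a sequence of star steps from size one, the numbers [0], [1], ..., [r - 2]
    are distributed over the modes, each mode missing those of the steps centred
    at it. For [r = 4] and [r = 5] they cannot be split into three classes of
    equal sum, so the last step is replaced by one where a link between [X1] and
    [X3] is traded for a link between [X2] and [X3]. *)
Lemma slices_determined_3 (K : fieldType) :
  slices_determined K 3 [:: (0, 1)]%N [:: (2, 1)]%N [:: (1, 0); (2, 1)]%N
    [:: (0, 1); (0, 2)]%N [:: (2, 0); (2, 1)]%N [:: (0, 2); (2, 0)]%N.
Proof.
move=> X1 X2 X3 diag L1 L2 L3 Z1 Z2 Z3 a b am bm.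
have [? ? ?] := diag 0%N isT; have [? ? ?] := diag 1%N isT.
have [? ? ?] := diag 2%N isT.
have /= ? := Z1 (0, 1)%N isT; have /= ? := Z1 (0, 2)%N isT.
have /= ? := Z2 (2, 0)%N isT; have /= ? := Z2 (2, 1)%N isT.
have /= ? := Z3 (0, 2)%N isT; have /= ? := Z3 (2, 0)%N isT.
instances3 L1 (0, 1)%N; instances3 L2 (2, 1)%N.
instances3 L3 (1, 0)%N; instances3 L3 (2, 1)%N => *.
propagate_zeros.
by case: a b am bm => [|[|[|a]]] [|[|[|b]]] // _ _; split.
Qed.

Lemma slices_determined_4 (K : fieldType) :
  slices_determined K 4 [:: (0, 1)]%N [:: (2, 1); (3, 2)]%N
    [:: (1, 0); (2, 1); (3, 2)]%N [:: (0, 1); (0, 2); (0, 3); (1, 3)]%N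
    [:: (2, 1); (3, 0); (3, 1); (3, 2)]%N [:: (0, 2); (0, 3); (3, 0); (3, 2)]%N.
Proof.
move=> X1 X2 X3 diag L1 L2 L3 Z1 Z2 Z3 a b am bm.
have [? ? ?] := diag 0%N isT; have [? ? ?] := diag 1%N isT.
have [? ? ?] := diag 2%N isT; have [? ? ?] := diag 3%N isT.
have /= ? := Z1 (0, 1)%N isT; have /= ? := Z1 (0, 2)%N isT.
have /= ? := Z1 (0, 3)%N isT; have /= ? := Z1 (1, 3)%N isT.
have /= ? := Z2 (2, 1)%N isT; have /= ? := Z2 (3, 0)%N isT.
have /= ? := Z2 (3, 1)%N isT; have /= ? := Z2 (3, 2)%N isT.
have /= ? := Z3 (0, 2)%N isT; have /= ? := Z3 (0, 3)%N isT.
have /= ? := Z3 (3, 0)%N isT; have /= ? := Z3 (3, 2)%N isT.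
instances4 L1 (0, 1)%N; instances4 L2 (2, 1)%N; instances4 L2 (3, 2)%N.
instances4 L3 (1, 0)%N; instances4 L3 (2, 1)%N; instances4 L3 (3, 2)%N => *.
propagate_zeros.
by case: a b am bm => [|[|[|[|a]]]] [|[|[|[|b]]]] // _ _; split.
Qed.

Lemma separable_1 (K : fieldType) : separable K 1 0 0 0.
Proof.
exists (fun _ _ _ => 0), (fun _ _ _ => 0), (fun _ _ _ => 0) => T off _ _ _ i j k.
by rewrite (ord1 i) (ord1 j) (ord1 k); case: (off ord0 ord0).
Qed.

Lemma separable_star_step2 (K : fieldType) (m e1 e2 e3 : nat) :
    infinite_type K -> (e3 <= m.-1 * m.-1)%N -> (m.-1 <= e2 + e3)%N ->
    (m * m.-1 <= e1 + e2 + e3)%N ->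
  separable K m.+1 e1 e2 e3 -> separable K m.+2 (e1 + m) e2 (e3 + m).
Proof.
move=> hK le3 le23 le_all /separable_swap12 sep; apply: separable_swap12.
by apply: separable_star_step sep; rewrite // (addnC e2).
Qed.

Lemma separable_star_step3 (K : fieldType) (m e1 e2 e3 : nat) :
    infinite_type K -> (e2 <= m.-1 * m.-1)%N -> (m.-1 <= e3 + e2)%N ->
    (m * m.-1 <= e1 + e2 + e3)%N ->
  separable K m.+1 e1 e2 e3 -> separable K m.+2 (e1 + m) (e2 + m) e3.
Proof.
move=> hK le2 le32 le_all /separable_swap23 sep; apply: separable_swap23.
by apply: separable_star_step2 sep; rewrite // addnAC.
Qed.

(** Centred in the modes 1, 2, 3, 3, 2, 1, six consecutive star steps are
    balanced: the numbers [m], ..., [m + 5] of matrices missed by the centres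
    pair up to the same sum [2 m + 5]. *)
Lemma separable_six_steps (K : fieldType) (m d : nat) :
    infinite_type K -> (m * m.-1 <= 3 * d <= m * m.-1 + 2)%N ->
  separable K m.+1 d d d ->
  let d' := (d + (4 * m + 10))%N in separable K (m + 6).+1 d' d' d'.
Proof.
move=> hK /andP [lo hi] s0 d'.
have s1 : separable K m.+2 d (d + m) (d + m).
  by apply: separable_star_step s0 => //; case: m lo hi {d'} => [|[|[|m]]] /=; nia.
have s2 : separable K m.+3 (d + m.+1) (d + m) (d + m + m.+1).
  by apply: separable_star_step2 s1 => //; case: m lo hi {s0 d'} => [|[|[|m]]] /=; nia.
have s3 : separable K m.+4 (d + m.+1 + m.+2) (d + m + m.+2) (d + m + m.+1).
  by apply: separable_star_step3 s2 => //;
    case: m lo hi {s0 s1 d'} => [|[|[|m]]] /=; nia.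
have s4 : separable K m.+4.+1 (d + m.+1 + m.+2 + m.+3) (d + m + m.+2 + m.+3)
    (d + m + m.+1).
  by apply: separable_star_step3 s3 => //;
    case: m lo hi {s0 s1 s2 d'} => [|[|[|m]]] /=; nia.
have s5 : separable K m.+4.+2 (d + m.+1 + m.+2 + m.+3 + m.+4)
    (d + m + m.+2 + m.+3) (d + m + m.+1 + m.+4).
  by apply: separable_star_step2 s4 => //;
    case: m lo hi {s0 s1 s2 s3 d'} => [|[|[|m]]] /=; nia.
have s6 : separable K m.+4.+3 (d + m.+1 + m.+2 + m.+3 + m.+4)
    (d + m + m.+2 + m.+3 + m.+4.+1) (d + m + m.+1 + m.+4 + m.+4.+1).
  by apply: separable_star_step s5 => //;
    case: m lo hi {s0 s1 s2 s3 s4 d'} => [|[|[|m]]] /=; nia.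
rewrite (_ : (m + 6).+1 = m.+4.+3); last by lia.
by apply: separable_leq s6; rewrite /d'; lia.
Qed.

Lemma separable_minimal (K : fieldType) (m d : nat) :
    infinite_type K -> (m * m.-1 <= 3 * d <= m * m.-1 + 2)%N ->
  separable K m.+1 d d d.
Proof.
move=> hK; have [N] := ubnP m; elim: N m d => // N IHN m d lt_m.
have s2 : separable K 2 0 0 0 := 
    @separable_star_step K 0 0 0 0 hK isT isT isT (separable_1 K).
have s3 := @separable_star_step K 1 0 0 0 hK isT isT isT s2.
have [lt_m6 bd|le_6m bd] := ltnP m 6; last first.
  have -> : m = ((m - 6) + 6)%N by lia.
  have -> : d = ((d - (4 * (m - 6) + 10)) + (4 * (m - 6) + 10))%N by nia.
  have bd' : ((m - 6) * (m - 6).-1 <= 3 * (d - (4 * (m - 6) + 10))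
      <= (m - 6) * (m - 6).-1 + 2)%N by nia.
  by apply: separable_six_steps => //; apply: IHN => //; lia.
case: m lt_m6 bd {lt_m} => [|[|[|[|[|[|m]]]]]] // _ /= bd.
- by apply: separable_leq (separable_1 K); lia.
- by apply: separable_leq s2; lia.
- by apply: separable_leq s3; lia.
- have s4 := @separating_extend K 2 1 1 0 1 1 2 _ _ _ _ _ _ hK
    (@slices_determined_3 K) isT isT isT isT isT isT
    (separable_swap23 (separable_swap12 s3)).
  by apply: separable_leq s4; lia.
- have s3' := @separable_star_step2 K 1 0 0 0 hK isT isT isT s2.
  have s4 := @separable_star_step3 K 2 1 0 1 hK isT isT isT s3'.
  have s5 := @separating_extend K 3 3 2 1 1 2 3 _ _ _ _ _ _ hK
    (@slices_determined_4 K) isT isT isT isT isT isT s4.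
  by apply: separable_leq s5; lia.
- have s4 := @separable_star_step K 2 0 1 1 hK isT isT isT s3.
  have s5 := @separable_star_step2 K 3 0 3 3 hK isT isT isT s4.
  have s6 := @separable_star_step3 K 4 3 3 6 hK isT isT isT s5.
  by apply: separable_leq s6; lia.
Qed.

(** Families stay separating when they are enlarged, so only the least [d] matters,
    for which the system is square up to rounding. *)
Lemma separable_balanced (K : fieldType) (r d : nat) :
    infinite_type K -> (0 < r)%N -> (r.-1 * r.-2 <= 3 * d)%N ->
  separable K r d d d.
Proof.
case: r => // m hK _ /= le_d.
pose c := ((m * m.-1 + 2) %/ 3)%N.
have cP : (m * m.-1 <= 3 * c <= m * m.-1 + 2)%N.
  have := divn_eq (m * m.-1 + 2) 3; have := ltn_pmod (m * m.-1 + 2) (isT : 0 < 3)%N.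
  by rewrite -/c; lia.
by apply: separable_leq (separable_minimal hK cP); lia.
Qed.

(** * The generic subrank *)

Theorem corollary2p17 (K : fieldType) (hK : infinite_type K)
    (n : nat) (hn : (0 < n)%N) :
  is_generic_subrank K n n n (Nat.sqrt (3 * n - 2)).
Proof.
have [lo hi] : (Nat.sqrt (3 * n - 2) * Nat.sqrt (3 * n - 2) <= 3 * n - 2)%N /\
    (3 * n - 2 < (Nat.sqrt (3 * n - 2)).+1 * (Nat.sqrt (3 * n - 2)).+1)%N.
  have [] := PeanoNat.Nat.sqrt_spec (3 * n - 2) (PeanoNat.Nat.le_0_l _).
  by move=> /leP lo /ltP hi.
move: (Nat.sqrt _) lo hi => r lo hi; split; last first.
  move=> s; apply: contraPT; rewrite -ltnNge => lt_rs.
  by apply: subrank_ge_not_dense => //; apply: leq_trans hi _; apply: leq_mul.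
have r0 : (0 < r)%N by nia.
have le_rn : (r <= n)%N by nia.
have := @separable_dense K r (n - r) hK; rewrite subnKC //; apply.
by apply: separable_balanced => //; nia.
Qed.
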